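(* Let $I(n)=\{0,1,\dots,n\}$ and suppose $\{M_i\}_{i\in I(n)}$ is a corner of manifolds structure on $M$. (a) Suppose $W$ is a finite Coxeter group of rank $n+1$, with fundamental generators $S=\{s_i\}_{i\in I(n)}$ indexed by $I(n)$. Then $\mathcal U(W,M)$ is a closed manifold. (b) Suppose $L$ is a triangulation of a sphere and $f:L\to\Delta$ is a coloring, where $\Delta$ is the simplex on $I(n)$. Then the pullback $f^*(M)$ is a closed manifold.
   Context: A manifold with corners of dimension $m$ is a second countable Hausdorff space locally modeled on $[0,\infty)^m$ (differentiably, or topologically). For a point $x$, let $c(x)$ be the number of zero coordinates of $x$ in a chart; an open stratum of codimension $k$ is a component of $\{x\mid c(x)=k\}$ and a (closed) stratum is the closure of an open stratum. A corner structure over $I(n)$ on a path connected space $X$ is a family of closed subspaces $\{X_i\}_{i\in I(n)}$ such that $X_J:=\bigcap_{i\in J}X_i\neq\emptyset$ for all $J\subseteq I(n)$ (with $X_\emptyset=X$). If $M$ is a manifold with corners, a corner structure $\{M_i\}_{i\in I(n)}$ on $M$ is a corner of manifolds if each $M_J$ is a union of closed strata of codimension $|J|$. Basic construction: for $x\in M$ put $I(x)=\{i\mid x\in M_i\}$, and for $J\subseteq I(n)$ put $W_J=\langle s_i\mid i\in J\rangle$. Then $\mathcal U(W,M)=(W\times M)/\sim$, where $(w,x)\sim(w',x')$ iff $x=x'$ and $wW_{I(x)}=w'W_{I(x)}$. A coloring is a simplicial map from $L$ onto a simplex whose restriction to each simplex of $L$ is injective. Let $\mathcal S(L)$ be the poset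 of vertex sets of simplices of $L$, including $\emptyset$. Pullback: give $\mathcal S(L)$ the discrete topology and let $Q=\coprod_{J\in\mathcal S(L)}\{J\}\times M_{I(n)-f(J)}$. If $J'\subseteq J$ then $M_{I(n)-f(J')}\subseteq M_{I(n)-f(J)}$; let $\sim$ be the equivalence relation on $Q$ generated by identifying, whenever $J'\subseteq J$, $\{J'\}\times M_{I(n)-f(J')}$ with the corresponding subspace of $\{J\}\times M_{I(n)-f(J)}$. Then $f^*(M):=Q/\sim$.
   Formalization: The formal theorem also assumes that M is compact and that the M_i together cover the boundary of M; without these the claim fails (n=0, W=Z/2, M_0={0}: M=[0,∞) gives the line, M=[0,1] gives an interval). *)

(* Defs.v *)
From HB Require Import structures.
From Stdlib Require Import Relation_Operators.
From mathcomp Require Import all_boot all_order all_algebra all_fingroup.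
From mathcomp Require Import generic_quotient.
From mathcomp Require Import all_classical all_reals all_analysis.

Set Implicit Arguments.
Unset Strict Implicit.
Unset Printing Implicit Defensive.

Import Order.TTheory GRing.Theory Num.Theory.
Import numFieldNormedType.Exports.

Local Open Scope classical_set_scope.
Local Open Scope ring_scope.
Local Open Scope quotient_scope.

(** * Topological preliminaries *)

(* The inverse g is total on Y, but only its restriction to B matters. *)
Definition homeomorphism_on (X Y : topologicalType) (A : set X) (B : set Y)
    (f : X -> Y) : Prop :=
  exists g : Y -> X,
    [/\ (forall x, A x -> B (f x)) /\ (forall y, B y -> A (g y)),
        (forall x, A x -> g (f x) = x) /\ (forall y, B y -> f (g y) = y),
        {within A, continuous f} & {within B, continuous g}].

Definition path_connected (R : realType) (X : topologicalType) : Prop :=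
  forall x y : X, exists p : R -> X,
    [/\ {within `[0, 1], continuous p}, p 0 = x & p 1 = y].

(** * Manifolds and manifolds with corners *)

Definition is_chart (R : realType) (m : nat) (H : set 'rV[R]_m)
    (X : topologicalType) (U : set X) (phi : X -> 'rV[R]_m) : Prop :=
  open U /\
  exists2 O : set 'rV[R]_m, open O & homeomorphism_on U (H `&` O) phi.

Definition topological_manifold (R : realType) (d : nat) (X : topologicalType)
    : Prop :=
  [/\ hausdorff_space X, @second_countable X &
      forall x : X, exists (U : set X) (phi : X -> 'rV[R]_d),
        U x /\ is_chart setT U phi].

Definition closed_manifold (R : realType) (X : topologicalType) : Prop :=
  compact [set: X] /\ exists d : nat, topological_manifold R d X.

Definition orthant (R : realType) (m : nat) : set 'rV[R]_m :=
  [set v | forall i, 0 <= v 0 i].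

Definition zero_coordinates (R : realType) (m : nat) (v : 'rV[R]_m) : nat :=
  #|[pred i | v 0 i == 0]|.

(* The number of zero coordinates is not invariant under arbitrary
   homeomorphisms between open subsets of the orthant (a corner can be
   straightened), so compatibility of topological charts has to require that
   changes of charts preserve it.  Diffeomorphisms always do, hence every
   differentiable manifold with corners has an underlying structure of this
   kind. *)
Record manifold_with_corners (R : realType) (m : nat) (M : topologicalType) :=
  ManifoldWithCorners {
    mwc_hausdorff : hausdorff_space M;
    mwc_second_countable : @second_countable M;
    mwc_atlas : set (set M * (M -> 'rV[R]_m));
    mwc_chart : forall c, mwc_atlas c -> is_chart (@orthant R m) c.1 c.2;
    mwc_cover : forall x : M, exists2 c, mwc_atlas c & c.1 x;
    mwc_compatible : forall c c', mwc_atlas c -> mwc_atlas c' ->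
      forall x, c.1 x -> c'.1 x ->
        zero_coordinates (c.2 x) = zero_coordinates (c'.2 x) }.

Definition codim_set (R : realType) (m : nat) (M : topologicalType)
    (A : manifold_with_corners R m M) (k : nat) : set M :=
  [set x | exists c, [/\ mwc_atlas A c, c.1 x & zero_coordinates (c.2 x) = k]].

Definition open_stratum (R : realType) (m : nat) (M : topologicalType)
    (A : manifold_with_corners R m M) (k : nat) (E : set M) : Prop :=
  exists2 x, codim_set A k x & E = connected_component (codim_set A k) x.

Definition closed_stratum (R : realType) (m : nat) (M : topologicalType)
    (A : manifold_with_corners R m M) (k : nat) (E : set M) : Prop :=
  exists2 E0, open_stratum A k E0 & E = closure E0.

Definition mwc_boundary (R : realType) (m : nat) (M : topologicalType)
    (A : manifold_with_corners R m M) : set M :=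
  \bigcup_(k in [set k | (0 < k)%N]) codim_set A k.

(** * Corner structures; the index set I(n) = {0, ..., n} is ['I_n.+1] *)

Definition face (n : nat) (X : Type) (F : 'I_n.+1 -> set X)
    (J : {set 'I_n.+1}) : set X :=
  \bigcap_(i in [set` J]) F i.

Definition corner_structure (R : realType) (n : nat) (X : topologicalType)
    (F : 'I_n.+1 -> set X) : Prop :=
  [/\ path_connected R X, forall i, closed (F i) & forall J, face F J !=set0].

Definition corner_of_manifolds (R : realType) (m n : nat) (M : topologicalType)
    (A : manifold_with_corners R m M) (F : 'I_n.+1 -> set M) : Prop :=
  corner_structure R F /\
  forall J : {set 'I_n.+1}, exists2 D : set (set M),
    D `<=` closed_stratum A #|J| & face F J = \bigcup_(E in D) E.

(** * Coxeter groups *)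

(* The group gT has the presentation with generators s i and relations
   (s i * s j) ^+ m i j = 1, where m i j is the order of s i * s j in gT
   (finite, as gT is), m i i = 1 and m i j >= 2 for distinct i and j. *)
Definition finite_coxeter_system (n : nat) (gT : finGroupType)
    (s : 'I_n.+1 -> gT) : Prop :=
  [/\ injective s,
      forall i, #[s i]%g = 2,
      <<[set s i | i : 'I_n.+1]%SET>>%g = [set: gT]%SET &
      forall (H : groupType) (t : 'I_n.+1 -> H),
        (forall i j, (t i * t j) ^+ #[s i * s j] = 1)%g ->
        exists2 h : gT -> H,
          (forall x y, h (x * y) = h x * h y)%g & forall i, h (s i) = t i].

Definition special_subgroup (n : nat) (gT : finGroupType) (s : 'I_n.+1 -> gT)
    (J : {set 'I_n.+1}) : {set gT} :=
  <<[set s i | i in J]%SET>>%g.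

(** * The basic construction U(W, M) *)

Definition faces_at (n : nat) (X : Type) (F : 'I_n.+1 -> set X) (x : X)
    : {set 'I_n.+1} :=
  [set i | `[< F i x >]]%SET.

Section BasicConstruction.
Variables (n : nat) (gT : finGroupType) (s : 'I_n.+1 -> gT).
Variables (M : topologicalType) (F : 'I_n.+1 -> set M).

Definition basic_prespace : topologicalType :=
  (discrete_topology gT * M)%type.

Definition basic_rel : rel basic_prespace := fun p q =>
  (p.2 == q.2) &&
  (lcoset (special_subgroup s (faces_at F p.2)) p.1 ==
   lcoset (special_subgroup s (faces_at F q.2)) q.1).

Lemma basic_rel_refl : reflexive basic_rel.
Proof. by move=> p; rewrite /basic_rel !eqxx. Qed.

Lemma basic_rel_sym : symmetric basic_rel.
Proof. by move=> p q; rewrite /basic_rel eq_sym [X in _ && X]eq_sym. Qed.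

Lemma basic_rel_trans : transitive basic_rel.
Proof.
move=> q p r /andP[/eqP pq /eqP pq'] /andP[/eqP qr /eqP qr'].
by apply/andP; split; apply/eqP; [exact: etrans pq qr|exact: etrans pq' qr'].
Qed.

Canonical basic_equiv :=
  EquivRel basic_rel basic_rel_refl basic_rel_sym basic_rel_trans.

Definition basic_construction : topologicalType :=
  quotient_topology {eq_quot basic_equiv}.

End BasicConstruction.

(** * Simplicial complexes, colorings and pullbacks *)

(* L is the poset of vertex sets of simplices, including the empty one. *)
Definition simplicial_complex (V : finType) (L : {set {set V}}) : Prop :=
  [/\ (finset.set0 : {set V}) \in L, forall v : V, [set v]%SET \in L &
      forall J K : {set V}, J \in L -> K \subset J -> K \in L].

Definition geometric_realization (R : realType) (V : finType)
    (L : {set {set V}}) : set {ptws V -> R} :=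
  [set t | [/\ forall v, 0 <= t v, \sum_v t v = 1 &
               [set v | t v != 0]%SET \in L]].

Definition unit_sphere (R : realType) (d : nat) : set 'rV[R]_d.+1 :=
  [set v | \sum_i v 0 i ^+ 2 = 1].

Definition triangulates_a_sphere (R : realType) (V : finType)
    (L : {set {set V}}) : Prop :=
  simplicial_complex L /\
  exists (d : nat) (h : {ptws V -> R} -> 'rV[R]_d.+1),
    homeomorphism_on (@geometric_realization R V L) (@unit_sphere R d) h.

(* Every map of vertex sets is simplicial as a map to the full simplex on
   ['I_n.+1]; "onto" means that every simplex of the latter is an image. *)
Definition coloring (n : nat) (V : finType) (L : {set {set V}})
    (f : V -> 'I_n.+1) : Prop :=
  (forall J : {set V}, J \in L -> {in J &, injective f}) /\
  (forall K : {set 'I_n.+1}, exists2 J : {set V}, J \in L & f @: J = K).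

Section Pullback.
Variables (n : nat) (V : finType) (L : {set {set V}}) (f : V -> 'I_n.+1).
Variables (M : topologicalType) (F : 'I_n.+1 -> set M).

Definition pullback_piece (J : {J : {set V} | J \in L}) : topologicalType :=
  set_type (face F (~: (f @: val J))).

(* The topology on a sigma type is the one of the disjoint union. *)
Definition pullback_prespace : topologicalType :=
  {J : {J : {set V} | J \in L} & pullback_piece J}.

Definition pullback_step (p q : pullback_prespace) : Prop :=
  (val (projT1 p) \subset val (projT1 q)) /\
  set_val (projT2 p) = set_val (projT2 q).

Definition pullback_rel : rel pullback_prespace := fun p q =>
  `[< clos_refl_sym_trans pullback_prespace pullback_step p q >].

Lemma pullback_rel_refl : reflexive pullback_rel.
Proof. by move=> p; apply/asboolP; exact: rst_refl. Qed.

Lemma pullback_rel_sym : symmetric pullback_rel.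
Proof. by move=> p q; apply/asboolP/asboolP => h; exact: rst_sym. Qed.

Lemma pullback_rel_trans : transitive pullback_rel.
Proof.
by move=> q p r /asboolP pq /asboolP qr; apply/asboolP; exact: rst_trans pq qr.
Qed.

Canonical pullback_equiv :=
  EquivRel pullback_rel pullback_rel_refl pullback_rel_sym pullback_rel_trans.

Definition pullback : topologicalType :=
  quotient_topology {eq_quot pullback_equiv}.

End Pullback.

(* Main.v *)
Require Import Defs.
From HB Require Import structures.
From Stdlib Require Import Relation_Operators.
From mathcomp Require Import all_boot all_order all_algebra all_fingroup.
From mathcomp Require Import generic_quotient.
From mathcomp Require Import all_classical all_reals all_analysis.
From mathcomp Require Import ring lra zify.

Set Implicit Arguments.
Unset Strict Implicit.
Unset Printing Implicit Defensive.

Import Order.TTheory GRing.Theory Num.Theory.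
Import numFieldNormedType.Exports.

Local Open Scope classical_set_scope.
Local Open Scope ring_scope.

(** Both spaces are obtained by gluing finitely many copies of faces of M, and
the same recipe applied to the chamber K = [0, oo)^(n+1) instead of M yields a
Euclidean space.  For U(W, K) this is the action of W on the dual of its
geometric representation, for which K is a strict fundamental domain with
stabilizers the special subgroups (Tits).  For f^*(K) it is the open cone on
|L|, homeomorphic to the open cone on a sphere; this model needs no assumption
on the links in L, which need not be spheres.  A chart of M around x can be
straightened so that M_i becomes the face y_i = 0 of K x R^(m-n-1), for all i
at once.  Gluing is local in M, so a neighbourhood of each point of the glued
space is an open subset of a Euclidean space times R^(m-n-1). *)

(** * Convergence *)

(** Whether two copies are identified over a point x depends only on the set of i with x in M_i, and
    identifications increase with that set; so one relation [E] describes both the gluing of faces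
    of M and the gluing of chamber faces. The obstacle is that an atlas of M records codimensions
    but not indices. Near x, the part of one coordinate hyperplane lying off all the others is
    connected and of codimension 1, so M_i contains all of it as soon as it meets it. Some M_i does,
    since the boundary is covered, and only one does, since M_i and M_j meet in closures of
    codimension 2 strata. On the Coxeter side, maximizing a functional over a finite orbit leads
    into the chamber, and positivity of roots shows that an orbit meets the chamber only once. *)

Lemma cvg_within_comp (T X Y : topologicalType) (A : set X) (f : X -> Y)
    (g : T -> X) (G : set_system T) {FG : Filter G} (y : X) :
  {within A, continuous f} -> A y ->
  g @ G --> y -> (\forall t \near G, A (g t)) -> (f \o g) @ G --> f y.
Proof.
move=> /subspace_continuousP cf Ay gy Ay' V /(cf _ Ay) Vy.
have {}Vy : \forall x \near y, A x -> V (f x) by [].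
have {}gy : \forall t \near G, A (g t) -> V (f (g t)) := gy _ Vy.
change (\forall t \near G, V (f (g t))).
by apply: filterS2 gy Ay' => t; exact.
Qed.

Lemma mx_cvgP (T : Type) (Y : topologicalType) (m n : nat) (f : T -> 'M[Y]_(m, n))
    (G : set_system T) {FG : Filter G} (l : 'M[Y]_(m, n)) :
  f @ G --> l <-> forall i j, (f t i j @[t --> G]) --> l i j.
Proof.
split=> [fl i j V Vl|fl V [P Pl PV]].
  have : nbhs l (fun M : 'M[Y]_(m, n) => V (M i j)).
    exists (fun i' j' => [set y | i' = i -> j' = j -> V y]).
      move=> i' j'; have [ii|ii] := eqVneq i' i; last first.
        by apply: filterS filterT => y _ /eqP; rewrite (negPf ii).
      have [jj|jj] := eqVneq j' j; last first.
        by apply: filterS filterT => y _ _ /eqP; rewrite (negPf jj).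
      by rewrite ii jj; apply: filterS Vl => y Vy _ _.
    by move=> M MV; exact: MV.
  by move=> /fl.
have : \forall t \near G, forall i, forall j, P i j (f t i j).
  by apply: filter_forall => i; apply: filter_forall => j; exact: fl.
by apply: filterS => t /PV.
Qed.

Lemma coord_cvg (T : Type) (Y : topologicalType) (m n : nat)
    (f : T -> 'M[Y]_(m, n)) (G : set_system T) {FG : Filter G} (l : 'M[Y]_(m, n)) i j :
  f @ G --> l -> (f t i j @[t --> G]) --> l i j.
Proof. by move=> /mx_cvgP. Qed.

Lemma row_mx_cvg (T : Type) (Y : topologicalType) (m n1 n2 : nat)
    (f : T -> 'M[Y]_(m, n1)) (g : T -> 'M[Y]_(m, n2)) (G : set_system T)
    {FG : Filter G} (l1 : 'M[Y]_(m, n1)) (l2 : 'M[Y]_(m, n2)) :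
  f @ G --> l1 -> g @ G --> l2 -> (row_mx (f t) (g t) @[t --> G]) --> row_mx l1 l2.
Proof.
move=> fl gl; apply/mx_cvgP => i j; rewrite -(splitK j).
case: (fintype.split j) => a /=.
  by rewrite row_mxEl; under eq_fun do rewrite row_mxEl; exact: coord_cvg.
by rewrite row_mxEr; under eq_fun do rewrite row_mxEr; exact: coord_cvg.
Qed.

Lemma lsubmx_cvg (T : Type) (Y : topologicalType) (m n1 n2 : nat)
    (f : T -> 'M[Y]_(m, n1 + n2)) (G : set_system T) {FG : Filter G}
    (l : 'M[Y]_(m, n1 + n2)) :
  f @ G --> l -> (lsubmx (f t) @[t --> G]) --> lsubmx l.
Proof.
move=> fl; apply/mx_cvgP => i j; rewrite mxE.
by under eq_fun do rewrite mxE; exact: coord_cvg.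
Qed.

Lemma rsubmx_cvg (T : Type) (Y : topologicalType) (m n1 n2 : nat)
    (f : T -> 'M[Y]_(m, n1 + n2)) (G : set_system T) {FG : Filter G}
    (l : 'M[Y]_(m, n1 + n2)) :
  f @ G --> l -> (rsubmx (f t) @[t --> G]) --> rsubmx l.
Proof.
move=> fl; apply/mx_cvgP => i j; rewrite mxE.
by under eq_fun do rewrite mxE; exact: coord_cvg.
Qed.

Lemma sum_cvg (R : realType) (T : Type) (G : set_system T) {FG : Filter G}
    (I : Type) (r : seq I) (P : pred I) (f : I -> T -> R) (l : I -> R) :
  (forall i, f i @ G --> l i) ->
  (\sum_(i <- r | P i) f i t @[t --> G]) --> \sum_(i <- r | P i) l i.
Proof.
move=> fl; elim: r => [|i r IHr].
  by rewrite big_nil; under eq_fun do rewrite big_nil; exact: cvg_cst.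
rewrite big_cons; under eq_fun do rewrite big_cons.
by case: (P i) => //; apply: cvgD.
Qed.

Lemma ptws_cvgP (R : realType) (V : eqType) (T : Type) (G : set_system T)
    {FG : Filter G} (f : T -> {ptws V -> R}) (l : {ptws V -> R}) :
  f @ G --> l <-> forall v, (f t v @[t --> G]) --> l v.
Proof.
split=> [fl v W Wl|fl].
  exact: fl _ (@proj_continuous V (fun=> R) v l W Wl).
apply/cvg_sup => v W [B [[D oD <-] Dl] BW].
have Dlv : nbhs (l v) D by exact: open_nbhs_nbhs.
have tD : \forall t \near G, D (f t v) := fl v _ Dlv.
change (\forall t \near G, W (f t)).
by apply: filterS tD => t Dt; exact: BW.
Qed.

Lemma minr_cvg (R : realType) (T : Type) (G : set_system T) {FG : Filter G}
    (f g : T -> R) (a b : R) : f @ G --> a -> g @ G --> b ->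
  (Num.min (f t) (g t) @[t --> G]) --> Num.min a b.
Proof.
move=> fa gb.
rewrite minr_absE; under eq_fun do rewrite minr_absE.
apply: (@cvgM _ _ G); last exact: cvg_cst.
apply: (@cvgB _ _ _ G); first exact: (@cvgD _ _ _ G).
by apply: (@cvg_norm _ _ _ G); exact: (@cvgB _ _ _ G).
Qed.

Lemma bigmin_cvg (R : realType) (T : Type) (G : set_system T) {FG : Filter G}
    (I : Type) (r : seq I) (P : pred I) (f0 : T -> R) (f : I -> T -> R)
    (l0 : R) (l : I -> R) :
  f0 @ G --> l0 -> (forall i, f i @ G --> l i) ->
  (\big[Num.min/f0 t]_(i <- r | P i) f i t @[t --> G]) -->
  \big[Num.min/l0]_(i <- r | P i) l i.
Proof.
move=> fl0 fl; elim: r => [|i r IHr].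
  by rewrite big_nil; under eq_fun do rewrite big_nil.
rewrite big_cons; under eq_fun do rewrite big_cons.
case: (P i) => //.
exact: minr_cvg.
Qed.

(** Closed pasting at one point: a piece that misses [x] has an open complement around it and
    imposes nothing nearby, and finitely many conditions hold on a common neighbourhood. *)
Lemma finite_closed_cover_cvg (I : finType) (X Y : topologicalType) (f : X -> Y)
    (C : I -> set X)    (g : I -> X -> Y) (x : X) :
  (forall i, closed (C i)) -> (forall z, exists i, C i z) ->
  (forall i z, C i z -> f z = g i z) -> (forall i, continuous (g i)) ->
  f @ nbhs x --> f x.
Proof.
move=> Ccl Ccov fg gc W Wx.
have H i : \forall z \near x, C i z -> W (f z).
  have [Cx|nCx] := pselect (C i x).
    have gW : nbhs x (g i @^-1` W) by apply: gc; rewrite -(fg _ _ Cx).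
    by apply: filterS gW => z gz Cz; rewrite (fg _ _ Cz).
  have : nbhs x (~` C i) by apply: open_nbhs_nbhs; split=> //; exact: closed_openC.
  by apply: filterS => z nCz /nCz.
have := filter_forall (nbhs_filter x) H.
change ((\forall z \near x, forall i, C i z -> W (f z)) -> \forall z \near x, W (f z)).
by apply: filterS => z Hz; have [i Ci] := Ccov z; exact: Hz Ci.
Qed.

(** * Gluing faces *)

Definition zeros (R : realType) (N : nat) (y : 'rV[R]_N) : {set 'I_N} :=
  [set i | y 0 i == 0]%SET.

Definition chamber_face (R : realType) (n : nat) (K : {set 'I_n.+1}) :
  set 'rV[R]_n.+1 := [set y | @orthant R n.+1 y /\ K \subset zeros y].

Lemma closed_chamber_face (R : realType) (n : nat) (K : {set 'I_n.+1}) :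
  closed (@chamber_face R n K).
Proof.
have coordc (i : 'I_n.+1) : continuous (fun y : 'rV[R]_n.+1 => y 0 i).
  by move=> y; exact: (@coord_cvg _ R 1 n.+1 id (nbhs y) _ y 0 i).
rewrite (_ : chamber_face K = \bigcap_i ((fun y : 'rV[R]_n.+1 => y 0 i) @^-1`
    [set r | 0 <= r /\ (i \in K -> r = 0)])).
  apply: closed_bigI => i _; apply: preimage_closed => [y _|]; first exact: coordc.
  apply: closedI; first exact: closed_ge.
  pose S := [set r : R | i \in K -> r = 0]; suff : closed S by [].
  have [iK|iK] := boolP (i \in K).
    have -> : S = [set r | r = 0]; last exact: closed_eq.
    by apply/seteqP; split=> r /=; [exact|move=> -> _].
  have -> : S = setT; last exact: closedT.
  by apply/seteqP; split=> r //= _ iK'; move: iK; rewrite iK'.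
apply/seteqP; split=> y /=.
  move=> [y0 /fintype.subsetP Ky] i _; split=> [|/Ky]; first exact: y0.
  by rewrite inE => /eqP.
move=> Hy; split=> [i|]; first by have [] := Hy i I.
by apply/fintype.subsetP => i iK; rewrite inE; have [_ ->] := Hy i I.
Qed.

(* In the first n+1 coordinates of such a chart [F i] is the i-th coordinate
   hyperplane; the remaining k coordinates are unconstrained. *)
Definition colored_chart (R : realType) (n k : nat) (M : topologicalType)
    (F : 'I_n.+1 -> set M) (U : set M) (psi : M -> 'rV[R]_(n.+1 + k)) : Prop :=
  is_chart [set v | @orthant R n.+1 (lsubmx v)] U psi /\
  forall x, U x -> faces_at F x = zeros (lsubmx (psi x)).

Section Faces.
Variables (n : nat) (M : topologicalType) (F : 'I_n.+1 -> set M).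
Hypothesis Fcl : forall i, closed (F i).

Lemma faceP (K : {set 'I_n.+1}) x : face F K x <-> K \subset faces_at F x.
Proof.
split=> [Kx|/fintype.subsetP Kx i /= /Kx]; last by rewrite inE => /asboolP.
by apply/fintype.subsetP => i iK; rewrite inE; apply/asboolP; exact: Kx.
Qed.

(** The faces are finitely many and closed, so those missing [x] miss a neighbourhood of it. For a
    gluing relation that is monotone in the set of faces, an identification at a nearby point then
    also holds at [x]. *)
Lemma near_faces_at x : \forall y \near x, faces_at F y \subset faces_at F x.
Proof.
have : \forall y \near x, forall i, i \notin faces_at F x -> ~ F i y.
  apply: filter_forall => i; have [iF|iF] := boolP (i \in faces_at F x).
    by apply: filterS filterT => y _ /negP.
  have : (~` F i) x by move=> Fx; move: iF; rewrite inE => /asboolP.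
  move=> Fx; have : nbhs x (~` F i).
    by apply: open_nbhs_nbhs; split=> //; exact: closed_openC.
  by apply: filterS => y Fy _.
apply: filterS => y Fy; apply/fintype.subsetP => i; rewrite inE => /asboolP Fiy.
by apply/negPn/negP => /Fy.
Qed.

Lemma closed_face K : closed (face F K).
Proof. by apply: closed_bigI => i _; exact: Fcl. Qed.

End Faces.

(** * Closed manifolds glued from faces, modeled on a Euclidean gluing of chamber faces *)

Section Gluing.
Variables (R : realType) (n k N : nat) (M Q : topologicalType).
Variables (F : 'I_n.+1 -> set M) (J : finType) (G : J -> {set 'I_n.+1}).
Variables (E : {set 'I_n.+1} -> rel J) (e : J -> M -> Q).
Variables (Phi : J -> 'rV[R]_n.+1 -> 'rV[R]_N) (q : 'rV[R]_N -> 'rV[R]_n.+1).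

(** The first block presents [Q], with the quotient topology, by copies of the faces [G j] of M
    glued according to [E]. The second presents Euclidean space by chamber faces with the same [J],
    [G] and [E]; there [q] folds the space back into the chamber. *)
Hypothesis Fcl : forall i, closed (F i).
Hypothesis Emono : forall (K K' : {set 'I_n.+1}) j j',
  K \subset K' -> E K j j' -> E K' j j'.
Hypothesis e_surj : forall c, exists j x, face F (G j) x /\ e j x = c.
Hypothesis e_eq : forall j j' x x', face F (G j) x -> face F (G j') x' ->
  e j x = e j' x' <-> x = x' /\ E (faces_at F x) j j'.
Hypothesis e_open : forall A : set Q, open A <->
  forall j x, face F (G j) x -> A (e j x) ->
    \forall y \near x, face F (G j) y -> A (e j y).

Hypothesis Phi_cont : forall j, {within chamber_face (G j), continuous (Phi j)}.
Hypothesis q_cont : continuous q.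
Hypothesis PhiK : forall j y, chamber_face (G j) y -> q (Phi j y) = y.
Hypothesis Phi_surj : forall p, exists j, chamber_face (G j) (q p) /\ Phi j (q p) = p.
Hypothesis Phi_eq : forall j j' y, chamber_face (G j) y -> chamber_face (G j') y ->
  Phi j y = Phi j' y <-> E (zeros y) j j'.

Hypothesis M_hausdorff : hausdorff_space M.
Hypothesis M_second : @second_countable M.
Hypothesis M_compact : compact [set: M].
Hypothesis M_chart : forall x, exists (U : set M) (psi : M -> 'rV[R]_(n.+1 + k)),
  U x /\ colored_chart F U psi.

Lemma glue_cvg j x (V : set Q) : face F (G j) x -> nbhs (e j x) V ->
  \forall y \near x, face F (G j) y -> V (e j y).
Proof.
rewrite nbhsE => jx [B [oB Bx] BV].
have /e_open/(_ j x jx Bx) := oB.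
by apply: filterS => y By jy; exact/BV/By.
Qed.

(** Near [x], a representative of a glued point can only come from a copy already identified with
    [j] at [x]; neighbourhoods of [e j x] are thus controlled by the copies through that point. *)
Lemma near_glue_eq j x : face F (G j) x -> \forall y \near x, face F (G j) y ->
  forall j' y', face F (G j') y' -> e j' y' = e j y ->
    y' = y /\ e j' x = e j x /\ face F (G j') x.
Proof.
move=> jx; have := near_faces_at Fcl x; apply: filterS => y yx jy j' y' jy'.
move=> /(e_eq jy' jy)[y'y Ey]; rewrite y'y in jy' Ey *; split=> //.
have j'x : face F (G j') x by apply/faceP/(fintype.subset_trans _ yx)/faceP.
by split=> //; apply/e_eq => //; split=> //; exact: Emono Ey.
Qed.

Lemma glue_hausdorff : hausdorff_space Q.
Proof.
rewrite open_hausdorff => c c'.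
have [j [x [jx <-]]] := e_surj c; have [j' [x' [jx' <-]]] := e_surj c' => {c c'}.
have [xx'|xx'] := eqVneq x x'; last first.
  have := M_hausdorff; rewrite open_hausdorff => /(_ x x' xx').
  move=> [[A B] /= []]; rewrite !inE => Ax Bx' [oA oB AB] _.
  pose S (D : set M) : set Q :=
    [set c | exists l z, [/\ face F (G l) z, D z & e l z = c]].
  have oS D : open D -> open (S D).
    move=> oD; apply/e_open => l z lz [l' [z' [lz' Dz' /(e_eq lz' lz)[zz' _]]]].
    have Dz : nbhs z D by rewrite -zz'; exact: open_nbhs_nbhs.
    by apply: filterS Dz => y Dy ly; exists l, y.
  exists (S A, S B); first by rewrite !inE; split; [exists j, x|exists j', x'].
  split; [exact: oS|exact: oS|apply/eqP].
  rewrite -subset0 => c [[l [z [lz Az <-]]]] [l' [z' [lz' Bz' ]]].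
  move=> /(e_eq lz' lz)[zz' _]; suff : (set0 : set M) z by [].
  by rewrite -AB; split=> //; rewrite -zz'.
rewrite -{x'}xx' in jx' * => jj'.
(* Over [D] the copy of a representative has a class at [x], and by monotonicity of [E] this class
   depends only on the glued point. Prescribing the class separates the two points over [x]. *)
pose D : set M := [set y | faces_at F y \subset faces_at F x].
have oD : open D.
  rewrite openE => y Dy; apply: filterS (near_faces_at Fcl y) => z zy.
  exact: fintype.subset_trans zy Dy.
pose S j0 : set Q :=
  [set c | exists l z, [/\ face F (G l) z, D z, e l z = c & e l x = e j0 x]].
have DE l z : face F (G l) z -> D z -> face F (G l) x.
  by move=> /faceP lz Dz; apply/faceP; exact: fintype.subset_trans lz Dz.
have SE l l' z : face F (G l) z -> face F (G l') z -> D z -> e l z = e l' z ->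
    e l x = e l' x.
  move=> lz lz' Dz /(e_eq lz lz')[_ Ez]; apply/e_eq; [exact: DE Dz|exact: DE Dz|].
  by split=> //; exact: Emono Ez.
have oS j0 : open (S j0).
  apply/e_open => l z lz [l' [z' [lz' Dz' ll' lx]]].
  have /(e_eq lz' lz)[zz' _] := ll'; rewrite zz' in lz' Dz' ll'.
  have Dz : nbhs z D by exact: open_nbhs_nbhs.
  apply: filterS Dz => y Dy ly; exists l, y; split=> //.
  by rewrite -lx; apply: SE (esym ll').
exists (S j, S j').
  have Dx : D x by rewrite /D /=.
  by rewrite !inE; split; [exists j, x|exists j', x].
split; [exact: oS|exact: oS|apply/eqP]; rewrite -subset0 => c [[l [z [lz Az <- lx]]]].
move=> [l' [z' [lz' Dz' ll' lx']]].
have /(e_eq lz' lz)[zz' _] := ll'; rewrite zz' in lz' Dz' ll'.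
by move: jj'; rewrite -lx -lx' (SE _ _ _ lz lz' Az (esym ll')) eqxx.
Qed.

Lemma glue_compact : compact [set: Q].
Proof.
have -> : [set: Q] = \big[setU/set0]_(j in J) (e j @` face F (G j)).
  rewrite eqEsubset; split=> // c _; rewrite -bigcup_seq.
  have [j [x [jx <-]]] := e_surj c; exists j; last by exists x.
  by rewrite /= mem_index_enum.
apply: bigsetU_compact => j _; apply: continuous_compact; last first.
  by apply: (subclosed_compact _ M_compact) => //; exact: closed_face.
apply/subspace_continuousP => x jx V Vx.
exact: glue_cvg.
Qed.

(** A basic set of [Q] comes from choosing one basic set of M for each of the finitely many copies,
    and requires every representative of a point to lie in the set chosen for its copy. *)
Lemma glue_second_countable : @second_countable Q.
Proof.
have [B /countable_injP[f finj] [Bo Bb]] := M_second.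
(* The shift by one reserves code 0 for the empty set, which is chosen for the copies that do not
   represent the given point. *)
pose b (c : nat) : set M := \bigcup_(D in [set D | B D /\ (f D).+1 = c]) D.
have bo c : open (b c) by apply: bigcup_open => D [BD _]; exact: Bo.
have bE O : B O -> b (f O).+1 = O.
  move=> BO; rewrite eqEsubset; split=> [x [D [BD [fD]] Dx]|x Ox].
    by rewrite -(finj D O) ?inE.
  by exists O.
have b0 : b 0 = set0 by rewrite -subset0 => x [D []].
pose V (phi : {ffun J -> nat}) : set Q :=
  [set c | forall j x, face F (G j) x -> e j x = c -> b (phi j) x].
exists (range V).
  apply: (@sub_countable _ _ _ [set: {ffun J -> nat}]); last exact: countableP.
  exact: card_image_le.
split=> [_ [phi _ <-]|c W Wc].
  apply/e_open => j x jx Vx.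
  have : \forall y \near x, forall j', face F (G j') x -> e j' x = e j x -> b (phi j') y.
    apply: filter_forall => j'.
    have [jx'|jx'] := pselect (face F (G j') x); last by apply: filterS filterT.
    have [jj'|jj'] := pselect (e j' x = e j x); last by apply: filterS filterT.
    have : nbhs x (b (phi j')) by apply: open_nbhs_nbhs; split=> //; exact: Vx.
    by apply: filterS.
  have := near_glue_eq jx; apply: filterS2 => y y1 y2 jy j' y' jy' ejy.
  by have [-> [? ?]] := y1 jy j' y' jy' ejy; exact: y2.
have [j [x [jx xc]]] := e_surj c; rewrite -{c}xc in Wc *.
have ch j' : exists c, (forall y, face F (G j') y -> b c y -> W (e j' y)) /\
    (face F (G j') x -> e j' x = e j x -> b c x).
  have [[jx' jj']|nj] := pselect (face F (G j') x /\ e j' x = e j x); last first.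
    by exists 0%N; rewrite b0; split=> // ? ?; case: nj.
  have := glue_cvg jx'; rewrite jj' => /(_ _ Wc).
  move=> /Bb[D [BD Dx] DW]; exists (f D).+1; rewrite bE//.
  by split=> // y jy Dy; exact: DW.
have [phi phiP] := choice ch.
exists (V [ffun j' => phi j']); first split; first by exists [ffun j' => phi j'].
  move=> j' x' jx' ejx; rewrite ffunE.
  have [xx' _] := (e_eq jx' jx).1 ejx; rewrite xx' in jx' ejx *.
  by have [_] := phiP j'; exact.
move=> c; have [j' [x' [jx' <-]]] := e_surj c => Vc.
have := Vc j' x' jx' erefl; rewrite ffunE.
by have [+ _] := phiP j'; exact.
Qed.

(** In each copy a chart of M is followed by the unfolding [Phi j] of its chamber block; copies
    agree because [E] governs both gluings. The inverse folds with [q], inverts the chart of M, and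
    uses any copy [ch] that unfolds to the given vector. *)
Lemma glue_chart c : exists (U : set Q) (phi : Q -> 'rV[R]_(N + k)),
  U c /\ is_chart setT U phi.
Proof.
have [sel selP] : {sel : Q -> J * M & forall d, face F (G (sel d).1) (sel d).2 /\
    e (sel d).1 (sel d).2 = d}%type.
  apply: (@choice _ _ (fun d jx => face F (G jx.1) jx.2 /\ e jx.1 jx.2 = d)) => d.
  by have [j [x jx]] := e_surj d; exists (j, x).
have [ch chP] := choice Phi_surj.
have [U [psi [Ux [[oU [ O oO [psi' [[mapU mapO] [K1 K2] c1 c2]]]] col]]]] :=
  M_chart (sel c).2.
have selE j x : face F (G j) x -> (sel (e j x)).2 = x.
  by move=> jx; have [js /(e_eq js jx)[]] := selP (e j x).
have colK j x : U x -> face F (G j) x -> chamber_face (G j) (lsubmx (psi x)).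
  move=> Ux' /faceP jx; split; last by rewrite -col.
  by have [] := mapU _ Ux'.
pose phi d := row_mx (Phi (sel d).1 (lsubmx (psi (sel d).2))) (rsubmx (psi (sel d).2)).
pose lift z := row_mx (q (lsubmx z)) (rsubmx z) : 'rV[R]_(n.+1 + k).
pose inv (z : 'rV[R]_(N + k)) := e (ch (lsubmx z)) (psi' (lift z)).
have phiE j x : U x -> face F (G j) x ->
    phi (e j x) = row_mx (Phi j (lsubmx (psi x))) (rsubmx (psi x)).
  move=> Ux' jx; rewrite /phi selE//; congr row_mx.
  have [js] := selP (e j x); rewrite selE// in js * => /(e_eq js jx)[_].
  by rewrite col// => Ex; apply/Phi_eq => //; exact: colK.
have phi_lift j x : U x -> face F (G j) x -> lift (phi (e j x)) = psi x.
  move=> Ux' jx; rewrite phiE// /lift row_mxKl row_mxKr PhiK ?hsubmxK//.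
  exact: colK.
have liftH z : O (lift z) -> ([set v | @orthant R n.+1 (lsubmx v)] `&` O) (lift z).
  by move=> Oz; split=> //=; rewrite row_mxKl; have [[]] := chP (lsubmx z).
have inv_face z j : O (lift z) -> chamber_face (G j) (q (lsubmx z)) ->
    face F (G j) (psi' (lift z)).
  move=> Oz [_ jz]; apply/faceP; have Hz := liftH _ Oz.
  by rewrite col ?K2//; [rewrite row_mxKl|exact: mapO].
have ch_face z : O (lift z) -> face F (G (ch (lsubmx z))) (psi' (lift z)).
  by move=> Oz; apply: inv_face => //; have [] := chP (lsubmx z).
have eE z j : O (lift z) -> chamber_face (G j) (q (lsubmx z)) ->
    Phi j (q (lsubmx z)) = lsubmx z -> inv z = e j (psi' (lift z)).
  move=> Oz jz Pz; have [cz Pcz] := chP (lsubmx z).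
  apply/e_eq; [exact: ch_face|exact: inv_face|split=> //].
  rewrite col ?K2; [|exact: liftH|exact: mapO (liftH _ Oz)].
  by rewrite row_mxKl; apply/Phi_eq => //; rewrite Pcz Pz.
exists [set d | U (sel d).2], phi; split=> //; split.
  apply/e_open => j x jx /=; rewrite selE// => Ux'.
  have : nbhs x U by exact: open_nbhs_nbhs.
  by apply: filterS => y Uy jy; rewrite selE.
have ql_cvg (z : 'rV[R]_(N + k)) : q (lsubmx y) @[y --> z] --> q (lsubmx z).
  apply: (@cvg_comp _ _ _ lsubmx q _ (nbhs (lsubmx z))); last exact: q_cont.
  exact: (@lsubmx_cvg _ _ _ _ _ id (nbhs z)).
have lift_cvg z : lift y @[y --> z] --> lift z.
  apply: (@row_mx_cvg _ _ _ _ _ (q \o lsubmx) rsubmx (nbhs z)).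
    exact: ql_cvg.
  exact: (@rsubmx_cvg _ _ _ _ _ id (nbhs z)).
exists [set z | O (lift z)].
  by rewrite openE => z Oz; apply: lift_cvg; exact: open_nbhs_nbhs.
exists inv; split.
- split=> [d Ud|z [_ /= Oz]] /=.
    split=> //=; have [jd <-] := selP d; rewrite phi_lift//.
    by have [] := mapU _ Ud.
  rewrite /inv selE; first exact: mapO (liftH _ Oz).
  exact: ch_face.
- split=> [d Ud|z [_ /= Oz]].
    have [jd Ed] := selP d.
    have ld : lift (phi d) = psi (sel d).2 by rewrite -[in LHS]Ed phi_lift.
    have Od : O (lift (phi d)) by rewrite ld; have [] := mapU _ Ud.
    have ll : lsubmx (phi d) = Phi (sel d).1 (lsubmx (psi (sel d).2)).
      by rewrite /phi row_mxKl.
    rewrite (eE _ (sel d).1)//; first by rewrite ld K1.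
      by rewrite ll PhiK; exact: colK.
    by rewrite ll PhiK//; exact: colK.
  rewrite phiE; [|exact: mapO (liftH _ Oz)|exact: ch_face].
  rewrite K2; last exact: liftH.
  by rewrite row_mxKl row_mxKr; have [_ ->] := chP (lsubmx z); rewrite hsubmxK.
- apply/subspace_continuousP => d Ud V.
  rewrite nbhsE => -[B [oB Bd] BV].
  pose A := [set d | U (sel d).2 /\ B (phi d)].
  have oA : open A.
    apply/e_open => j x jx; rewrite /A/= selE// => -[Ux'].
    rewrite phiE// => Bx; pose D := face F (G j) `&` U.
    have Dx : D x by [].
    have FW : Filter (within D (nbhs x)) by exact: within_filter.
    have psiW : psi @ within D (nbhs x) --> psi x.
      have /subspace_continuousP/(_ x Ux') := c1.
      by apply: cvg_trans; apply: cvg_app; apply: within_subset => y [].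
    have hW : row_mx (Phi j (lsubmx (psi y))) (rsubmx (psi y)) @[y --> within D (nbhs x)]
        --> row_mx (Phi j (lsubmx (psi x))) (rsubmx (psi x)).
      apply: (@row_mx_cvg _ _ _ _ _ (Phi j \o (lsubmx \o psi)) (rsubmx \o psi)).
        apply: (cvg_within_comp (g := lsubmx \o psi) (@Phi_cont j)) => //; first exact: colK.
          exact: lsubmx_cvg.
        by apply: (@filterE _ (nbhs x)) => y [jy Uy]; exact: colK.
      exact: rsubmx_cvg.
    have : nbhs x U by exact: open_nbhs_nbhs.
    have {}hW : \forall y \near x, D y ->
        B (row_mx (Phi j (lsubmx (psi y))) (rsubmx (psi y))).
      exact: hW B (open_nbhs_nbhs (conj oB Bx)).
    move: hW; apply: filterS2 => y Dy Uy jy.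
    by rewrite selE// phiE//; split=> //; exact: Dy.
  have : nbhs d A by apply: open_nbhs_nbhs; split.
  by apply: filterS => d' [_ Bd'] _; exact: BV.
- apply/subspace_continuousP => z [_ /= Oz] V Vz.
  (* The choice [ch] may jump near [z], so the claim is proved for each copy [j] over the [z'] that
     it represents, and finitely many neighbourhoods are intersected. *)
  suff H j : \forall z' \near z, O (lift z') -> chamber_face (G j) (q (lsubmx z')) ->
      Phi j (q (lsubmx z')) = lsubmx z' -> V (e j (psi' (lift z'))).
    change (\forall z' \near z, ([set: 'rV[R]_(N + k)] `&` [set z | O (lift z)]) z' ->
      V (inv z')).
    have := filter_forall (nbhs_filter z) H.
    apply: filterS => z' Hz' [_ /= Oz'].
    by have [? ?] := chP (lsubmx z'); exact: Hz'.
  have [qz|nqz] := pselect (chamber_face (G j) (q (lsubmx z))); last first.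
    have nq : nbhs (q (lsubmx z)) (~` @chamber_face R n (G j)).
      apply: open_nbhs_nbhs; split=> //.
      exact/closed_openC/closed_chamber_face.
    have : \forall z' \near z, ~ chamber_face (G j) (q (lsubmx z')) by exact: ql_cvg nq.
    by apply: filterS => z' nz' _ /nz'.
  pose D := [set z' | O (lift z') /\ chamber_face (G j) (q (lsubmx z'))].
  have FW : Filter (within D (nbhs z)) by exact: within_filter.
  have DW : \forall z' \near within D (nbhs z), D z'.
    by apply: (@filterE _ (nbhs z)).
  (* If [j] does not unfold to [z], continuity and the Hausdorff property show that it represents no
     [z'] close to [z] either. *)
  have [Pz|nPz] := eqVneq (Phi j (q (lsubmx z))) (lsubmx z); last first.
    have PW : Phi j (q (lsubmx z')) @[z' --> within D (nbhs z)] --> Phi j (q (lsubmx z)).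
      apply: (cvg_within_comp (g := q \o lsubmx) (@Phi_cont j)) => //.
        by apply: cvg_trans (@ql_cvg z); apply: cvg_app; exact: cvg_within.
      by apply: filterS DW => z' [].
    have lW : lsubmx z' @[z' --> within D (nbhs z)] --> lsubmx z.
      by apply: (@lsubmx_cvg _ _ _ _ _ id); exact: cvg_within.
    have := @norm_hausdorff _ 'rV[R]_N; rewrite open_hausdorff => /(_ _ _ nPz).
    move=> [[A B] /= []]; rewrite !inE => Az Bz [oA oB AB].
    have {}lW : \forall z' \near z, D z' -> B (lsubmx z').
      exact: lW B (open_nbhs_nbhs (conj oB Bz)).
    have {}PW : \forall z' \near z, D z' -> A (Phi j (q (lsubmx z'))).
      exact: PW A (open_nbhs_nbhs (conj oA Az)).
    move: PW lW; apply: filterS2 => z' A' B' Oz' qz' Pz'.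
    suff : (set0 : set 'rV[R]_N) (lsubmx z') by [].
    rewrite -AB; split; last by apply: B'; split.
    by rewrite -[X in A X]Pz'; apply: A'; split.
  have psiW : psi' (lift z') @[z' --> within D (nbhs z)] --> psi' (lift z).
    apply: (cvg_within_comp (g := lift) c2); first exact: liftH.
      by apply: cvg_trans (@lift_cvg z); apply: cvg_app; exact: cvg_within.
    by apply: filterS DW => z' [Oz' _]; exact: liftH.
  have {}Vz : nbhs (e j (psi' (lift z))) V by rewrite -(eE z j).
  have {}psiW : \forall z' \near z, D z' -> face F (G j) (psi' (lift z')) ->
      V (e j (psi' (lift z'))).
    exact: psiW _ (glue_cvg (inv_face _ _ Oz qz) Vz).
  move: psiW; apply: filterS => z' Hz' Oz' qz' Pz'; apply: Hz'; first by split.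
  exact: inv_face.
Qed.

Lemma glue_closed_manifold : closed_manifold R Q.
Proof.
split; first exact: glue_compact.
exists (N + k)%N; split; [exact: glue_hausdorff|exact: glue_second_countable|].
exact: glue_chart.
Qed.

End Gluing.

(** * The geometric representation *)

Section UnitsGroup.
Variable U : unitRingType.

(** The universal property of a Coxeter presentation ranges over [groupType]; invertible matrices
    are packaged as one so that it applies to the simple reflections. *)
Record units_of := UnitsOf { units_val :> U; _ : units_val \is a GRing.unit }.
HB.instance Definition _ := [isSub for units_val].
HB.instance Definition _ := [Choice of units_of by <:].

Lemma units_valP (x : units_of) : units_val x \is a GRing.unit.
Proof. by case: x. Qed.

Definition units_one := UnitsOf (unitr1 U).
Definition units_inv (x : units_of) :=
  UnitsOf (etrans (unitrV (units_val x)) (units_valP x)).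
Definition units_mul (x y : units_of) :=
  UnitsOf (etrans (unitrMl (units_val x) (units_valP y)) (units_valP x)).

Lemma units_mulA : associative units_mul.
Proof. by move=> x y z; apply: val_inj; rewrite /= mulrA. Qed.
Lemma units_mul1 : left_id units_one units_mul.
Proof. by move=> x; apply: val_inj; rewrite /= mul1r. Qed.
Lemma units_mulr1 : right_id units_one units_mul.
Proof. by move=> x; apply: val_inj; rewrite /= mulr1. Qed.
Lemma units_mulV : left_inverse units_one units_inv units_mul.
Proof. by move=> x; apply: val_inj; rewrite /= mulVr ?units_valP. Qed.
Lemma units_mulrV : right_inverse units_one units_inv units_mul.
Proof. by move=> x; apply: val_inj; rewrite /= mulrV ?units_valP. Qed.

HB.instance Definition _ := isGroup.Build units_of
  units_mulA units_mul1 units_mulr1 units_mulV units_mulrV.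

Lemma units_val_exp (x : units_of) k : units_val (x ^+ k)%g = units_val x ^+ k.
Proof.
by elim: k => [|k IHk]; rewrite ?expg0 ?expr0// expgS exprS -IHk.
Qed.

End UnitsGroup.

Section GeometricRepresentation.
Variables (R : realType) (n : nat) (gT : finGroupType) (s : 'I_n.+1 -> gT).
Hypothesis sinj : injective s.
Hypothesis s2 : forall i, #[s i]%g = 2%N.
Implicit Types i j : 'I_n.+1.

Local Notation E i := (delta_mx i 0 : 'cV[R]_n.+1).

Definition cox_angle i j : R := pi / (#[s i * s j]%g)%:R.
(** This is -2B(e_i, v) for the Tits form B(e_i, e_j) = -cos(pi / m_ij), and [cox_mx i] is the
    corresponding reflection. Since [s i * s i] has order 1, the diagonal angle is pi and B(e_i,
    e_i) = 1. *)
Definition cox_form i (v : 'cV[R]_n.+1) : R :=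
  \sum_j 2 * cos (cox_angle i j) * v j 0.
Definition cox_mx i : 'M[R]_n.+1 :=
  1%:M + E i *m \row_j (2 * cos (cox_angle i j)).

Lemma sM i : (s i * s i = 1)%g.
Proof. by rewrite -expg2 -(s2 i) expg_order. Qed.

Lemma sV i : (s i)^-1%g = s i.
Proof. by apply/eqP; rewrite eq_invg_mul sM. Qed.

Lemma cox_angleC i j : cox_angle i j = cox_angle j i.
Proof. by rewrite /cox_angle -orderV invgM !sV. Qed.

Lemma cox_orderC i j : #[s i * s j]%g = #[s j * s i]%g.
Proof. by rewrite -orderV invgM !sV. Qed.

Lemma cox_mxE i v : cox_mx i *m v = v + cox_form i v *: E i.
Proof.
rewrite /cox_mx mulmxDl mul1mx -mulmxA; congr (_ + _).
apply/matrixP => a b; rewrite !mxE big_ord1 !ord1 !mxE mulrC; congr (_ * _).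
by apply: eq_bigr => j _; rewrite !mxE.
Qed.

Lemma cox_formE i j : cox_form i (E j) = 2 * cos (cox_angle i j).
Proof.
rewrite /cox_form (bigD1 j)//= big1 ?addr0 => [|k kj].
  by rewrite !mxE !eqxx mulr1.
by rewrite !mxE (negPf kj) mulr0.
Qed.

Lemma cox_formii i : cox_form i (E i) = -2.
Proof. by rewrite cox_formE /cox_angle sM order1 divr1 cospi mulrN1. Qed.

Lemma cox_formD i u v : cox_form i (u + v) = cox_form i u + cox_form i v.
Proof.
by rewrite /cox_form -big_split; apply: eq_bigr => j _; rewrite !mxE mulrDr.
Qed.

Lemma cox_formZ i a v : cox_form i (a *: v) = a * cox_form i v.
Proof.
rewrite /cox_form big_distrr; apply: eq_bigr => j _ /=; rewrite !mxE.
by rewrite mulrCA.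
Qed.

Lemma cox_mx_simple i : cox_mx i *m E i = - E i.
Proof. by rewrite cox_mxE cox_formii; apply/matrixP => a b; rewrite !mxE; lra. Qed.

Lemma cox_mxK i : cox_mx i * cox_mx i = 1.
Proof.
have H (v : 'cV_n.+1) : cox_mx i *m (cox_mx i *m v) = v.
  rewrite !cox_mxE cox_formD cox_formZ cox_formii.
  by apply/matrixP => a b; rewrite !mxE; lra.
apply/matrixP => a b; have := H (E b).
rewrite mulmxA => /matrixP/(_ a 0).
by rewrite -colE !mxE eqxx andbT.
Qed.

Section Dihedral.
Variables (i j : 'I_n.+1).
Hypothesis ij : i != j.
Local Notation th := (cox_angle i j).
Local Notation m := (#[s i * s j]%g).

Lemma cox_order_gt1 : (1 < m)%N.
Proof.
rewrite order_gt1; apply: contraNneq ij => sij.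
by apply/eqP/sinj; rewrite -[LHS]mulg1 -(sM j) mulgA sij mul1g.
Qed.

Lemma cox_angle_le k : (k <= m)%N -> 0 <= k%:R * th <= pi.
Proof.
move=> km; have m0 : 0 < m%:R :> R by rewrite ltr0n order_gt0.
rewrite mulr_ge0 ?ler0n ?divr_ge0 ?pi_ge0 ?ler0n//=.
by rewrite mulrCA ger_pMr ?pi_gt0// ler_pdivrMr// mul1r ler_nat.
Qed.

Lemma cox_sin_gt0 : 0 < sin th.
Proof.
have m1 := cox_order_gt1.
have m0 : 0 < m%:R :> R by rewrite ltr0n order_gt0.
apply: sin_gt0_pi; rewrite divr_gt0 ?pi_gt0//=.
by rewrite gtr_pMr ?pi_gt0// invf_lt1// ltr1n.
Qed.

(* Along an alternating word in [s i], [s j] the images of the simple roots have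
   consecutive [cox_p] as coordinates; these are nonnegative up to length m. *)
Definition cox_p k : R := sin (k%:R * th) / sin th.

Lemma cox_p0 : cox_p 0 = 0.
Proof. by rewrite /cox_p mul0r sin0 mul0r. Qed.

Lemma cox_p1 : cox_p 1 = 1.
Proof. by rewrite /cox_p mul1r divff ?gt_eqF ?cox_sin_gt0. Qed.

Lemma cox_pSS k : cox_p k.+2 = 2 * cos th * cox_p k.+1 - cox_p k.
Proof.
have s0 : sin th != 0 by rewrite gt_eqF ?cox_sin_gt0.
rewrite /cox_p.
have -> : k.+2%:R * th = k.+1%:R * th + th by rewrite -[k.+2]addn1 natrD mulrDl mul1r.
have -> : k%:R * th = k.+1%:R * th - th by rewrite -[k.+1]addn1 natrD mulrDl mul1r addrK.
by rewrite sinB sinD; field.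
Qed.

Lemma cox_p_ge0 k : (k <= m)%N -> 0 <= cox_p k.
Proof.
by move=> km; apply: divr_ge0; [exact/sin_ge0_pi/cox_angle_le|exact/ltW/cox_sin_gt0].
Qed.

Lemma cox_p2m : cox_p (2 * m) = 0.
Proof.
have m0 : m%:R != 0 :> R by rewrite pnatr_eq0 -lt0n order_gt0.
have -> : cox_p (2 * m) = sin (pi *+ 2) / sin th.
  by rewrite /cox_p natrM mulr2n; congr (sin _ / _); rewrite /cox_angle; field.
by rewrite sin2pi mul0r.
Qed.

Lemma cox_p2m1 : cox_p (2 * m).+1 = 1.
Proof.
have m0 : m%:R != 0 :> R by rewrite pnatr_eq0 -lt0n order_gt0.
have -> : cox_p (2 * m).+1 = sin (th + pi *+ 2) / sin th.
  rewrite /cox_p -[(2 * m).+1]addn1 natrD natrM mulr2n.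
  by congr (sin _ / _); rewrite /cox_angle; field.
by rewrite sinD2pi divff ?gt_eqF ?cox_sin_gt0.
Qed.

End Dihedral.

(** The recursion swaps [i] and [j], so the last letter is always [j] and the parity of the length
    decides the first. *)
Fixpoint altw k i j : seq 'I_n.+1 :=
  if k is k'.+1 then rcons (altw k' j i) j else [::].

Definition wmx (t : seq 'I_n.+1) : 'M[R]_n.+1 := \prod_(l <- t) cox_mx l.

Lemma wmx_rcons t j : wmx (rcons t j) = wmx t * cox_mx j.
Proof. by rewrite /wmx big_rcons. Qed.

Lemma cox_pC i j k : cox_p i j k = cox_p j i k.
Proof. by rewrite /cox_p cox_angleC. Qed.

Lemma cox_mx_step i j a : i != j ->
  cox_mx j *m (cox_p i j a *: E j + cox_p i j a.+1 *: E i) =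
  cox_p i j a.+1 *: E i + cox_p i j a.+2 *: E j.
Proof.
move=> ij; rewrite cox_mxE cox_formD !cox_formZ cox_formii cox_formE cox_pSS//.
by rewrite (cox_angleC j i); apply/matrixP => x y; rewrite !mxE; ring.
Qed.

(** Each reflection advances a pair of consecutive [cox_p] by one index, through their Chebyshev
    recurrence. The starting index [a] stays free because each letter also exchanges the roles of
    [i] and [j]. *)
Lemma wmx_altw k i j a : i != j ->
  wmx (altw k i j) *m (cox_p i j a *: E j + cox_p i j a.+1 *: E i) =
  cox_p i j (a + k) *: (if odd k then E i else E j) +
  cox_p i j (a + k).+1 *: (if odd k then E j else E i).
Proof.
elim: k i j a => [|k IHk] i j a ij /=.
  by rewrite /wmx big_nil mul1mx addn0.
rewrite wmx_rcons -mulmxA cox_mx_step// !(cox_pC i j) IHk 1?eq_sym//.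
by rewrite addSnnS; case: (odd k).
Qed.

Lemma wmx_altw2 k i j : wmx (altw (2 * k) i j) = (cox_mx i * cox_mx j) ^+ k.
Proof.
elim: k => [|k IHk]; first by rewrite muln0 /wmx big_nil.
by rewrite mulnS /= !wmx_rcons IHk exprSr mulrA.
Qed.

Lemma cox_mx_fix i j : i != j ->
  (cox_mx i * cox_mx j) ^+ #[s i * s j]%g *m E i = E i.
Proof.
move=> ij; rewrite -wmx_altw2.
have := wmx_altw (2 * #[s i * s j]%g) 0 ij.
by rewrite cox_p0 cox_p1// scale0r add0r scale1r => ->; rewrite oddM /= add0n
  cox_p2m// cox_p2m1// scale0r add0r scale1r.
Qed.

Lemma cox_mx_inv i j k :
  (cox_mx i * cox_mx j) ^+ k * (cox_mx j * cox_mx i) ^+ k = 1.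
Proof.
elim: k => [|k IHk]; first by rewrite mulr1.
rewrite exprSr exprS mulrA -[_ * _ * (cox_mx j * _)]mulrA.
by rewrite -(mulrA (cox_mx i)) (mulrA (cox_mx j)) cox_mxK mul1r cox_mxK mulr1.
Qed.

Lemma cox_mx_form0 i j k v : cox_form i v = 0 -> cox_form j v = 0 ->
  (cox_mx i * cox_mx j) ^+ k *m v = v.
Proof.
move=> vi vj; elim: k => [|k IHk]; first by rewrite expr0 mul1mx.
rewrite exprSr -!mulmxA (cox_mxE j) vj scale0r addr0.
by rewrite (cox_mxE i) vi scale0r addr0.
Qed.

(** For distinct [i] and [j] the power fixes both simple roots and all vectors on which both forms
    vanish. The Gram determinant of the two roots is a nonzero multiple of a squared sine, so these
    vectors span. *)
Lemma cox_mx_rel i j : (cox_mx i * cox_mx j) ^+ #[s i * s j]%g = 1.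
Proof.
have [->|ij] := eqVneq i j; first by rewrite sM order1 expr1 cox_mxK.
set m := #[_]%g; set B := _ ^+ m.
have Bi : B *m E i = E i by exact: cox_mx_fix.
have Bj : B *m E j = E j.
  have ji : j != i by rewrite eq_sym.
  rewrite -[in LHS](cox_mx_fix ji) (cox_orderC j i) mulmxA.
  by have -> : B *m _ = 1 := cox_mx_inv i j m; exact: mul1mx.
suff Bv (v : 'cV_n.+1) : B *m v = v.
  apply/matrixP => a b; have /matrixP/(_ a 0) := Bv (E b).
  by rewrite -colE !mxE eqxx andbT.
set c := 2 * cos (cox_angle i j).
have c4 : 4 - c ^+ 2 != 0.
  have -> : 4 - c ^+ 2 = 4 * sin (cox_angle i j) ^+ 2.
    by rewrite /c -[in RHS](addrK (cos (cox_angle i j) ^+ 2) (sin _ ^+ 2))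
      [sin _ ^+ 2 + _]addrC cos2Dsin2; ring.
  by rewrite mulf_neq0 ?expf_neq0// gt_eqF// cox_sin_gt0.
(* Cramer's rule: [a] and [b] are chosen so that subtracting these multiples of the two roots makes
   both forms vanish. *)
pose a := - (2 * cox_form i v + c * cox_form j v) / (4 - c ^+ 2).
pose b := - (2 * cox_form j v + c * cox_form i v) / (4 - c ^+ 2).
pose v0 := v + (- a) *: E i + (- b) *: E j.
have vi : cox_form i v0 = 0.
  rewrite /v0 !cox_formD !cox_formZ cox_formii cox_formE -/c /a /b.
  by field.
have vj : cox_form j v0 = 0.
  rewrite /v0 !cox_formD !cox_formZ cox_formii cox_formE cox_angleC -/c /a /b.
  by field.
have Ev : v = v0 + a *: E i + b *: E j.
  by apply/matrixP => x y; rewrite !mxE; ring.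
have Bv0 : B *m v0 = v0 by exact: cox_mx_form0.
rewrite Ev; clearbody v0 a b.
by rewrite !mulmxDr -!scalemxAr Bi Bj Bv0.
Qed.

Lemma cox_mx_unit i : cox_mx i \is a GRing.unit.
Proof. by apply/unitrP; exists (cox_mx i); rewrite cox_mxK. Qed.

End GeometricRepresentation.

Lemma geometric_representation (R : realType) (n : nat) (gT : finGroupType)
    (s : 'I_n.+1 -> gT) : finite_coxeter_system s ->
  exists rho : gT -> 'M[R]_n.+1,
    [/\ rho 1%g = 1, forall x y, rho (x * y)%g = rho x * rho y &
        forall i, rho (s i) = cox_mx R s i].
Proof.
move=> [sinj s2 _ univ].
pose t i : units_of 'M[R]_n.+1 := UnitsOf (cox_mx_unit R s2 i).
have trel i j : ((t i * t j) ^+ #[s i * s j] = 1)%g.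
  by apply: val_inj; rewrite /= units_val_exp; exact: cox_mx_rel.
have [h hM hs] := univ _ _ trel.
exists (fun w => units_val (h w)); split => [|x y|i]; first last.
- by rewrite hs.
- by rewrite hM.
have /(congr1 (fun x => x * (h 1)^-1)%g) := hM 1%g 1%g.
by rewrite mul1g mulgK mulgV => <-.
Qed.

(** * Word length, signs of roots, and the chamber as fundamental domain *)

Section TitsPositivity.
Variables (R : realType) (n : nat) (gT : finGroupType) (s : 'I_n.+1 -> gT).
Hypothesis sinj : injective s.
Hypothesis s2 : forall i, #[s i]%g = 2%N.
Hypothesis sgen : (<<[set s i | i : 'I_n.+1]%SET>>%g = [set: gT]%SET).
Variable rho : gT -> 'M[R]_n.+1.
Hypothesis rho1 : rho 1%g = 1.
Hypothesis rhoM : forall x y, rho (x * y)%g = rho x * rho y.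
Hypothesis rhos : forall i, rho (s i) = cox_mx R s i.
Implicit Types (i j : 'I_n.+1) (w v x y : gT) (t u : seq 'I_n.+1).

Local Notation E i := (delta_mx i 0 : 'cV[R]_n.+1).

Definition word_val t : gT := (\prod_(l <- t) s l)%g.

Lemma word_val_nil : word_val [::] = 1%g.
Proof. by rewrite /word_val big_nil. Qed.

Lemma word_val_cons i t : word_val (i :: t) = (s i * word_val t)%g.
Proof. by rewrite /word_val big_cons. Qed.

Lemma word_val_rcons i t : word_val (rcons t i) = (word_val t * s i)%g.
Proof. by rewrite /word_val big_rcons. Qed.

Lemma word_val_cat t u : word_val (t ++ u) = (word_val t * word_val u)%g.
Proof. by rewrite /word_val big_cat. Qed.

Lemma word_ex w : exists k, [exists t : k.-tuple 'I_n.+1, word_val t == w].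
Proof.
suff [t tw] : exists t, word_val t = w.
  by exists (size t); apply/existsP; exists (in_tuple t); rewrite /= tw.
have : w \in <<[set s i | i : 'I_n.+1]%SET>>%g by rewrite sgen inE.
move=> /gen_prodgP[k [c cS ->]].
elim: k c cS => [|k IHk] c cS.
  by exists [::]; rewrite word_val_nil big_ord0.
rewrite big_ord_recl; have [t <-] := IHk _ (fun o => cS (lift ord0 o)).
have /imsetP[i _ ->] := cS ord0.
by exists (i :: t); rewrite word_val_cons.
Qed.

Definition cox_len w := ex_minn (word_ex w).

Lemma cox_len_word w : exists2 t, word_val t = w & size t = cox_len w.
Proof.
rewrite /cox_len; case: ex_minnP => k /existsP[t /eqP tw] _.
by exists t => //; rewrite size_tuple.
Qed.

Lemma cox_len_le t : (cox_len (word_val t) <= size t)%N.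
Proof.
rewrite /cox_len; case: ex_minnP => k _; apply.
by apply/existsP; exists (in_tuple t); rewrite /=.
Qed.

Lemma cox_len_mul x y : (cox_len (x * y)%g <= cox_len x + cox_len y)%N.
Proof.
have [t <- <-] := cox_len_word x; have [u <- <-] := cox_len_word y.
by rewrite -word_val_cat -size_cat cox_len_le.
Qed.

Lemma mulgsK w i : (w * s i * s i)%g = w.
Proof. by rewrite -mulgA sM ?mulg1. Qed.

Lemma cox_len_descent w : w != 1%g -> exists i, (cox_len (w * s i)%g < cox_len w)%N.
Proof.
have [t tw <-] := cox_len_word w; rewrite -{}tw.
case/lastP: t => [|t i]; first by rewrite word_val_nil eqxx.
by exists i; rewrite word_val_rcons mulgsK size_rcons ltnS cox_len_le.
Qed.

Lemma rho_word t : rho (word_val t) = wmx R s t.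
Proof.
elim/last_ind: t => [|t i IHt]; first by rewrite word_val_nil /wmx big_nil.
by rewrite word_val_rcons wmx_rcons rhoM IHt rhos.
Qed.

Lemma altw_cons k i j :
  altw k.+1 i j = (if odd k then i else j) :: altw k i j.
Proof.
elim: k i j => [//|k IHk] i j.
rewrite [LHS]/= -/(altw k.+1 j i) IHk /=.
by case: (odd k).
Qed.

Lemma size_altw k i j : size (altw k i j) = k.
Proof. by elim: k i j => //= k IHk i j; rewrite size_rcons IHk. Qed.

Lemma altw_cat a b i j :
  altw (a + b) i j =
  (if odd b then altw a j i else altw a i j) ++ altw b i j.
Proof.
elim: b i j => [|b IHb] i j; first by rewrite addn0 cats0.
by rewrite addnS /= IHb rcons_cat; case: (odd b).
Qed.

Lemma word_val_altwV k i j :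
  (word_val (altw k i j))^-1%g =
  word_val (if odd k then altw k i j else altw k j i).
Proof.
elim: k i j => [|k IHk] i j; first by rewrite word_val_nil invg1.
rewrite [in LHS]/= word_val_rcons invgM IHk sV// -word_val_cons /=.
rewrite -!/(altw k.+1 _ _) !altw_cons; by case: (odd k).
Qed.

Lemma word_val_altw2 k i j : word_val (altw (2 * k) i j) = ((s i * s j) ^+ k)%g.
Proof.
elim: k => [|k IHk]; first by rewrite muln0 word_val_nil.
by rewrite mulnS /= !word_val_rcons IHk expgSr mulgA.
Qed.

(** The alternating word of length 2m has value 1; cut it into halves and invert one of them. *)
Lemma cox_braid i j : let m := #[s i * s j]%g in
  word_val (altw m i j) = word_val (altw m j i).
Proof.
move=> m; have : word_val (altw (2 * m) i j) = 1%g.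
  by rewrite word_val_altw2 expg_order.
rewrite mul2n -addnn altw_cat word_val_cat => /eqP.
rewrite -eq_invg_mul => /eqP <-.
by case: ifP => om; rewrite word_val_altwV om.
Qed.

(** A repeated letter at the end would cancel and leave a shorter word with the same value. *)
Lemma reduced_altw i j t : i != j -> all (pred2 i j) t ->
  (forall u, word_val u = word_val t -> (size t <= size u)%N) ->
  t = altw (size t) i j \/ t = altw (size t) j i.
Proof.
move=> ij; elim/last_ind: t => [|t l IHt]; first by left.
rewrite all_rcons => /andP[lij tij] red.
have {}IHt : t = altw (size t) i j \/ t = altw (size t) j i.
  apply: IHt => // u ut; have := red (rcons u l).
  by rewrite !word_val_rcons ut !size_rcons; apply.
have tl u : t <> rcons u l.
  move=> tu; have := red u; rewrite tu !word_val_rcons mulgsK !size_rcons.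
  by move=> /(_ erefl); lia.
rewrite size_rcons.
case: (size t) IHt => [|k] /= IHt.
  have -> : t = [::] by case: IHt.
  by case/orP: lij => /eqP ->; [right|left].
case/orP: lij tl => /eqP -> tl.
  by case: IHt => tE; [right; rewrite tE|case: (tl _ tE)].
by case: IHt => tE; [case: (tl _ tE)|left; rewrite tE].
Qed.

Lemma cox_simple_ge0 i a : 0 <= E i a 0.
Proof. by rewrite mxE ler0n. Qed.

(* Tits: write [w = v * word_val t] with [t] a word in [s i], [s j] that is as long
   as lengths add up, where [s j] is a right descent of [w].  By induction [v] maps
   both simple roots to nonnegative vectors, and [t] is an alternating word ending
   in [j] and shorter than the order of [s i * s j], so that it maps the i-th
   simple root to a nonnegative combination of the two. *)
Lemma cox_root_ge0 w i : (cox_len w <= cox_len (w * s i)%g)%N ->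
  forall a, 0 <= (rho w *m E i) a 0.
Proof.
have [l] := ubnP (cox_len w); elim: l w i => // l IHl w i wl wi a.
have [->|w1] := eqVneq w 1%g; first by rewrite rho1 mul1mx cox_simple_ge0.
have [j wj] := cox_len_descent w1.
have ij : i != j by apply: contraTneq wj => <-; rewrite -leqNgt.
pose P k := `[< exists v t, [/\ w = (v * word_val t)%g, size t = k,
  all (pred2 i j) t & (cox_len v + k <= cox_len w)%N] >].
have P1 : P 1%N.
  apply/asboolP; exists (w * s j)%g, [:: j]; split => //.
  - by rewrite word_val_cons word_val_nil mulg1 mulgsK.
  - by rewrite /= eqxx orbT.
  - by rewrite addn1.
have Pmax k : P k -> (k <= cox_len w)%N by move=> /asboolP[v [t [_ _ _]]]; lia.
case: (ex_maxnP (ex_intro (fun k => P k) 1%N P1) Pmax) => k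
  /asboolP[v [t [wE tk tij vk]]] kmax.
have k1 := kmax _ P1.
have vup l' : pred2 i j l' -> (cox_len v <= cox_len (v * s l')%g)%N.
  move=> l'ij; rewrite leqNgt; apply/negP => vl.
  have : P k.+1.
    apply/asboolP; exists (v * s l')%g, (l' :: t); split.
    - by rewrite word_val_cons mulgA mulgsK.
    - by rewrite /= tk.
    - exact/andP.
    - lia.
  by move=> /kmax; lia.
have tred u : word_val u = word_val t -> (size t <= size u)%N.
  move=> ut; have := cox_len_mul v (word_val u); rewrite ut -wE -ut.
  by have := cox_len_le u; lia.
(* As [w * s i] is at least as long as [w], which has length at least that of [v] plus [k], fewer
   letters cannot complete [v] to it. *)
have wsi u : (w * s i)%g = (v * word_val u)%g -> (k <= size u)%N.
  move=> wu; have := cox_len_mul v (word_val u); rewrite -wu.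
  by have := cox_len_le u; lia.
have tE : t = altw k i j.
  case: (reduced_altw ij tij tred); rewrite tk// => tE.
  case: k tk k1 tE wsi {P1 Pmax kmax vk} => // k tk _ /= tE /(_ (altw k i j)).
  by rewrite size_altw wE tE word_val_rcons mulgA mulgsK => /(_ erefl); lia.
(* Otherwise the braid relation rewrites the last m letters so that they end in [i]; cancelling this
   letter against [s i] completes [v] to [w * s i] with only [k] - 1 letters, against [wsi]. *)
have km : (k < #[s i * s j]%g)%N.
  rewrite ltnNge; apply/negP => mk.
  set m := #[_]%g in mk; have m0 : (0 < m)%N by exact: order_gt0.
  set q := if odd m then altw (k - m) j i else altw (k - m) i j.
  have tq : word_val t = word_val (q ++ altw m j i).
    by rewrite tE -(subnK mk) altw_cat !word_val_cat cox_braid.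
  have sq : size q = (k - m)%N by rewrite /q; case: ifP; rewrite size_altw.
  have := wsi (q ++ altw m.-1 i j); rewrite size_cat size_altw sq.
  rewrite wE tq -(prednK m0) /= -rcons_cat word_val_rcons mulgA mulgsK.
  by move=> /(_ erefl); lia.
have vi : forall a, 0 <= (rho v *m E i) a 0.
  by apply: IHl; [lia|apply: vup; rewrite /= eqxx].
have vj : forall a, 0 <= (rho v *m E j) a 0.
  by apply: IHl; [lia|apply: vup; rewrite /= eqxx orbT].
have := wmx_altw R sinj s2 k 0 ij.
rewrite cox_p0 cox_p1// scale0r add0r scale1r -tE -rho_word add0n => tEi.
rewrite wE rhoM -[_ * _ *m _]mulmxA tEi mulmxDr -!scalemxAr.
have vo b : 0 <= (rho v *m (if b then E i else E j)) a 0 by case: b.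
rewrite mxE; move: (vo (odd k)) (vo (~~ odd k)).
set x := rho v *m _; rewrite if_neg => x0; set y := rho v *m _ => y0.
clearbody x y; rewrite !mxE addr_ge0// mulr_ge0 ?cox_p_ge0 ?(ltnW km)//.
Qed.

Lemma cox_root_le0 w i : (cox_len (w * s i)%g < cox_len w)%N ->
  forall a, (rho w *m E i) a 0 <= 0.
Proof.
move=> wi a; have := @cox_root_ge0 (w * s i)%g i.
rewrite mulgsK => /(_ (ltnW wi) a).
by rewrite rhoM rhos -mulmxA cox_mx_simple// mulmxN mxE oppr_ge0.
Qed.

Implicit Types z : 'rV[R]_n.+1.

Lemma rho_root_sign w i : (forall a, 0 <= (rho w *m E i) a 0) \/
  (forall a, (rho w *m E i) a 0 <= 0).
Proof.
have [le|lt] := leqP (cox_len w) (cox_len (w * s i)%g).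
  by left; exact: cox_root_ge0.
by right; exact: cox_root_le0.
Qed.

Definition abs_col (v : 'cV[R]_n.+1) : 'cV[R]_n.+1 := \col_a `|v a 0|.

(* A positive combination of the positive roots: every simple reflection lowers it,
   so a point of the orbit of [z] maximizing it lies in the chamber. *)
Definition root_sum : 'cV[R]_n.+1 := \sum_w \sum_j abs_col (rho w *m E j).

Lemma cox_form_sum (I : finType) (F : I -> 'cV[R]_n.+1) i :
  cox_form s i (\sum_k F k) = \sum_k cox_form s i (F k).
Proof.
apply: (big_morph (cox_form s i)); first exact: cox_formD.
by rewrite -(scale0r 0) cox_formZ mul0r.
Qed.

Lemma cox_formB i (v : 'cV[R]_n.+1) : cox_form s i v = (cox_mx R s i *m v) i 0 - v i 0.
Proof. by rewrite cox_mxE !mxE !eqxx mulr1 addrAC subrr add0r. Qed.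

(** For a root r with absolute value |r|, the form at |r| is at most |s_i r|_i - |r|_i, as roots
    have constant sign. Multiplication by [s i] permutes the roots, so these bounds sum to 0; the
    inequality is strict at the simple root [i], where it reads -2 < 0. *)
Lemma cox_form_root_sum i : cox_form s i root_sum < 0.
Proof.
pose b x j := `|(rho x *m E j) i 0|.
have le x j : cox_form s i (abs_col (rho x *m E j)) <= b (s i * x)%g j - b x j.
  have bE : b (s i * x)%g j = `|(cox_mx R s i *m (rho x *m E j)) i 0|.
    by rewrite /b rhoM rhos mulmxA.
  have [r0|r0] := rho_root_sign x j.
    have -> : abs_col (rho x *m E j) = rho x *m E j.
      by apply/matrixP => a c; rewrite mxE ger0_norm// ord1.
    by rewrite cox_formB bE /b (ger0_norm (r0 i)) lerD2r ler_norm.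
  have -> : abs_col (rho x *m E j) = - (rho x *m E j).
    by apply/matrixP => a c; rewrite mxE ler0_norm// ord1 [RHS]mxE.
  have oE (A : 'cV[R]_n.+1) : (- A) i 0 = - A i 0 by rewrite mxE.
  rewrite cox_formB bE /b (ler0_norm (r0 i)) mulmxN !oE lerD2r.
  by rewrite -normrN ler_norm.
have sum0 : \sum_x \sum_j (b (s i * x)%g j - b x j) = 0.
  under eq_bigr do rewrite big_split/=.
  rewrite big_split/= [X in _ + X](eq_bigr (fun x => - \sum_j b x j)); last first.
    by move=> x _; rewrite sumrN.
  rewrite sumrN; apply/eqP; rewrite subr_eq0; apply/eqP.
  by rewrite [RHS](reindex_inj (mulgI (s i))).
rewrite -sum0 /root_sum cox_form_sum (bigD1 1%g)// [ltRHS](bigD1 1%g)//=.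
apply: ltr_leD; last first.
  by apply: ler_sum => x _; rewrite cox_form_sum; exact: ler_sum.
rewrite cox_form_sum (bigD1 i)//= [ltRHS](bigD1 i)//=.
apply: ltr_leD; last exact: ler_sum.
rewrite /b mulg1 rhos rho1 mul1mx cox_mx_simple//.
have -> : abs_col (E i) = E i.
  by apply/matrixP => a c; rewrite !mxE !ord1 normr_nat.
by rewrite cox_formii// !mxE !eqxx normrN normr1 subrr oppr_lt0.
Qed.

Lemma cox_orbit z : exists w, forall i, 0 <= (z *m rho w) 0 i.
Proof.
pose f w : R := (z *m rho w *m root_sum) 0 0.
have [w _ wmax] : exists2 w, true & forall x, f x <= f w.
  case: (@arg_maxP _ _ _ 1%g xpredT f) => // w _ wmax.
  by exists w => // x; exact: wmax.
exists w => i; rewrite leNgt; apply/negP => zi.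
have := wmax (w * s i)%g; rewrite leNgt => /negP; apply.
rewrite /f rhoM rhos.
have -> : z *m (rho w * cox_mx R s i) *m root_sum =
    z *m rho w *m (cox_mx R s i *m root_sum) by rewrite !mulmxA.
rewrite cox_mxE mulmxDr [ltRHS]mxE ltrDl -scalemxAr -colE mxE.
by rewrite nmulr_rgt0 ?cox_form_root_sum// mxE.
Qed.

Lemma cox_fix z w : w \in special_subgroup s (zeros z) -> z *m rho w = z.
Proof.
have grp : group_set [set x | z *m rho x == z]%SET.
  apply/group_setP; split=> [|x y]; first by rewrite inE rho1 mulmx1.
  rewrite !inE => /eqP zx /eqP zy.
  by rewrite rhoM [_ * _]/(_ *m _) mulmxA zx zy.
suff /fintype.subsetP/(_ w) H : special_subgroup s (zeros z) \subset Group grp.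
  by move=> /H; rewrite inE => /eqP.
rewrite gen_subG; apply/fintype.subsetP => x /imsetP[i]; rewrite inE => /eqP zi ->.
rewrite inE rhos /cox_mx mulmxDr mulmx1 mulmxA -colE.
suff -> : col i z = 0 by rewrite mul0mx addr0.
by apply/matrixP => a b; rewrite !mxE !ord1.
Qed.

Lemma cox_mx_fixed z i : z 0 i = 0 -> z *m cox_mx R s i = z.
Proof.
move=> zi; rewrite -rhos cox_fix//; apply: mem_gen.
by apply/imsetP; exists i; rewrite ?inE ?zi.
Qed.

(** Induction on length: a right descent [s i] of [w] sends the simple root [i] to a nonpositive
    vector, which forces coordinate [i] of [z'] to vanish. Then [s i] fixes [z'], and the shorter
    [w * s i] still maps [z] to [z']. *)
Lemma cox_stabilizer z z' w : (forall i, 0 <= z 0 i) -> (forall i, 0 <= z' 0 i) ->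
  z *m rho w = z' -> z = z' /\ w \in special_subgroup s (zeros z).
Proof.
move=> z0; have [l] := ubnP (cox_len w); elim: l w z' => // l IHl w z' wl z'0 zw.
have [w1|/cox_len_descent[i wi]] := eqVneq w 1%g.
  by move: zw; rewrite w1 rho1 mulmx1 => ->; split => //; exact: group1.
have z'i : z' 0 i = 0.
  apply/eqP; rewrite eq_le z'0 andbT -zw.
  have -> : (z *m rho w) 0 i = (z *m (rho w *m E i)) 0 0.
    by rewrite mulmxA -colE [RHS]mxE.
  rewrite mxE; apply: sumr_le0 => a _; rewrite mulr_ge0_le0//.
  exact: cox_root_le0.
have [|//|zz' ws] := IHl (w * s i)%g z' _ z'0.
- by lia.
- by rewrite rhoM rhos [_ * _]/(_ *m _) mulmxA zw cox_mx_fixed.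
split=> //; rewrite -(mulgsK w i) groupM//; apply: mem_gen.
by apply/imsetP; exists i; rewrite ?inE// zz' z'i.
Qed.

Lemma rhoV w : rho w *m rho w^-1%g = 1%:M.
Proof. by rewrite -[_ *m _]rhoM mulgV rho1. Qed.

Lemma rhoVV w : rho w^-1%g *m rho w = 1%:M.
Proof. by rewrite -[_ *m _]rhoM mulVg rho1. Qed.

End TitsPositivity.

(** * The basic construction *)

Section BasicConstructionManifold.
Variables (R : realType) (n k : nat) (gT : finGroupType) (s : 'I_n.+1 -> gT).
Variables (M : topologicalType) (F : 'I_n.+1 -> set M).
Hypothesis coxs : finite_coxeter_system s.
Hypothesis Fcl : forall i, closed (F i).
Hypothesis M_hausdorff : hausdorff_space M.
Hypothesis M_second : @second_countable M.
Hypothesis M_compact : compact [set: M].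
Hypothesis M_chart : forall x, exists (U : set M) (psi : M -> 'rV[R]_(n.+1 + k)),
  U x /\ colored_chart F U psi.

Local Notation Q := (basic_construction s F).

Definition basic_point (w : gT) (x : M) : Q :=
  \pi_({eq_quot (basic_equiv s F)})%qT ((w, x) : basic_prespace gT M).

(* This is the relation [basic_rel] over a point [x] with [faces_at F x = K]. *)
Definition same_coset (K : {set 'I_n.+1}) (w w' : gT) : bool :=
  lcoset (special_subgroup s K) w == lcoset (special_subgroup s K) w'.

Lemma same_cosetE K w w' : same_coset K w w' = ((w^-1 * w')%g \in special_subgroup s K).
Proof.
rewrite /same_coset !lcosetE /special_subgroup -mem_lcoset eq_sym.
by apply/eqP/idP => [<-|/lcoset_eqP ->//]; rewrite ?lcoset_refl.
Qed.

Lemma basic_point_eq w w' x x' :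
  basic_point w x = basic_point w' x' <-> x = x' /\ same_coset (faces_at F x) w w'.
Proof.
rewrite /basic_point; split=> [/eqmodP/andP[/eqP /= xx']|[<- ww']].
  by rewrite xx' => ww'; split.
by apply/eqmodP/andP; split.
Qed.

Lemma basic_point_open (A : set Q) : open A <->
  forall w x, face F finset.set0 x -> A (basic_point w x) ->
    \forall y \near x, face F finset.set0 y -> A (basic_point w y).
Proof.
have f0 x : face F finset.set0 x by move=> i; rewrite /= inE.
split=> [oA w x _ Ax|H].
  have oB : open [set p : basic_prespace gT M | A (basic_point p.1 p.2)].
    rewrite (_ : [set _ | _] = \pi_({eq_quot (basic_equiv s F)})%qT @^-1` A).
      exact: oA.
    by apply/seteqP; split=> -[].
  have : nbhs ((w, x) : basic_prespace gT M) [set p | A (basic_point p.1 p.2)].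
    exact: open_nbhs_nbhs.
  move=> [[P S] /= [Pw Sx] PS]; apply: filterS Sx => y Sy _.
  by apply: (PS (w, y)); split=> //; exact: nbhs_singleton Pw.
change (open (\pi_({eq_quot (basic_equiv s F)})%qT @^-1` A)).
rewrite openE => -[w x] Ax; have := H w x (f0 x) Ax => Hx.
exists ([set w], [set y | A (basic_point w y)]).
  by split; [exact: discrete_set1|apply: filterS Hx => y; exact].
by move=> [w' y] /= [-> Ay].
Qed.

Lemma basic_construction_manifold : closed_manifold R Q.
Proof.
have [sinj s2 sgen _] := coxs.
have [rho [rho1 rhoM rhos]] := geometric_representation R coxs.
pose orb := cox_orbit sinj s2 sgen rho1 rhoM rhos.
pose stab := cox_stabilizer sinj s2 sgen rho1 rhoM rhos.
pose fx := cox_fix rho1 rhoM rhos.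
have rK w (z : 'rV[R]_n.+1) : z *m rho w *m rho w^-1%g = z.
  by rewrite -mulmxA rhoV// mulmx1.
have rVK w (z : 'rV[R]_n.+1) : z *m rho w^-1%g *m rho w = z.
  by rewrite -mulmxA rhoVV// mulmx1.
have rMz w w' (z : 'rV[R]_n.+1) : z *m rho (w * w')%g = z *m rho w *m rho w'.
  by rewrite rhoM mulmxA.
have uniq w w' (z : 'rV[R]_n.+1) : @orthant R n.+1 (z *m rho w) ->
    @orthant R n.+1 (z *m rho w') -> z *m rho w = z *m rho w'.
  move=> zw zw'; have := stab _ _ (w^-1 * w')%g zw zw'.
  by rewrite rMz rK => /(_ erefl)[].
have [ch chP] := choice orb.
pose q (z : 'rV[R]_n.+1) := z *m rho (ch z).
(* The inverse matches the left cosets of [basic_rel]: for an action on the right, y w^-1 = y w'^-1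
   says that w^-1 w' fixes y. *)
pose Phi w (y : 'rV[R]_n.+1) := y *m rho w^-1%g.
have mulmx_cont w : continuous (fun z : 'rV[R]_n.+1 => z *m rho w).
  move=> z; apply/(@mx_cvgP _ _ _ _ _ (nbhs z)) => i j; rewrite mxE.
  under eq_fun do rewrite mxE.
  apply: (@sum_cvg R _ (nbhs z) _ _ _ _ 
    (fun l (z : 'rV[R]_n.+1) => z i l * rho w l j)) => l.
  apply: (@cvgM _ _ (nbhs z)); last exact: cvg_cst.
  exact: (@coord_cvg _ R 1 n.+1 id (nbhs z) (nbhs_filter z) z i l (@cvg_id _ _)).
have cl0 (y : 'rV[R]_n.+1) : chamber_face finset.set0 y <-> @orthant R n.+1 y.
  by split=> [[]//|y0]; split=> //; exact: finset.sub0set.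
have closed_orthant : closed (@orthant R n.+1).
  rewrite (_ : @orthant R n.+1 = chamber_face finset.set0).
    exact: closed_chamber_face.
  by apply/seteqP; split=> y /cl0.
apply: (@glue_closed_manifold R n k n.+1 M Q F gT (fun=> finset.set0) same_coset
  basic_point Phi q) => //.
- move=> K K' w w' KK'; rewrite !same_cosetE; apply: (fintype.subsetP (genS _)).
  exact: imsetS.
- move=> c; case: (repr c) (reprK c) => w x cE; exists w, x; split.
    by move=> i; rewrite /= inE.
  exact: cE.
- by move=> w w' x x' _ _; exact: basic_point_eq.
- exact: basic_point_open.
- by move=> w; apply: continuous_subspaceT; exact: mulmx_cont.
(* On each of the finitely many closed translates of the chamber [q] is linear, because [uniq] makes
   the choice [ch] immaterial. *)
- move=> z; apply: (@finite_closed_cover_cvg gT _ _ q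
    (fun w => (fun z : 'rV[R]_n.+1 => z *m rho w) @^-1` @orthant R n.+1)
    (fun w z => z *m rho w)) => //.
  + by move=> w; apply: preimage_closed => // y _; exact: mulmx_cont.
  + by move=> w y yw; apply: uniq => //; exact: chP.
- move=> w y /cl0 y0; rewrite /q /Phi -[RHS](rVK w); apply: uniq; first exact: chP.
  by rewrite rVK.
- by move=> z; exists (ch z); split; [apply/cl0; exact: chP|rewrite /Phi /q rK].
- move=> w w' y /cl0 y0 _; rewrite same_cosetE; split=> [yE|ww'].
    have yy : y *m rho (w^-1 * w')%g = y by rewrite rMz [y *m _]yE rVK.
    by have [_] := stab _ _ _ y0 y0 yy.
  rewrite /Phi -[in RHS](fx y _ ww') rMz.
  by rewrite rK.
Qed.

End BasicConstructionManifold.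

(** * The cone on a triangulated sphere *)

Section SphereModel.
Variables (R : realType) (n : nat) (V : finType) (L : {set {set V}}).
Variables (f : V -> 'I_n.+1) (d : nat).
Variables (h : {ptws V -> R} -> 'rV[R]_d.+1) (g : 'rV[R]_d.+1 -> {ptws V -> R}).
Local Notation GL := (@geometric_realization R V L).
Local Notation S := (@unit_sphere R d).
Hypothesis L0 : (finset.set0 : {set V}) \in L.
Hypothesis Lsub : forall J K : {set V}, J \in L -> K \subset J -> K \in L.
Hypothesis finj : forall J : {set V}, J \in L -> {in J &, injective f}.
Hypothesis hS : forall t, GL t -> S (h t).
Hypothesis gGL : forall z, S z -> GL (g z).
Hypothesis hK : forall t, GL t -> g (h t) = t.
Hypothesis gK : forall z, S z -> h (g z) = z.
Hypothesis h_cont : {within GL, continuous h}.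
Hypothesis g_cont : {within S, continuous g}.
Implicit Types (t : {ptws V -> R}) (z : 'rV[R]_d.+1) (J : {set V}).

Definition supp t : {set V} := [set v | t v != 0]%SET.
Definition realization_cone : set {ptws V -> R} :=
  [set t | (forall v, 0 <= t v) /\ supp t \in L].
Definition norm1 t : R := \sum_v t v.
Definition norm2 z : R := Num.sqrt (\sum_i z 0 i ^+ 2).
Definition normalize t : {ptws V -> R} := fun v => (norm1 t)^-1 * t v.
(* The radial extension of [h]; at the apex [norm1 t = 0] makes the junk value of
   [h] irrelevant. *)
Definition cone_map t : 'rV[R]_d.+1 := norm1 t *: h (normalize t).
Definition cone_inv z : {ptws V -> R} :=
  fun v => norm2 z * g ((norm2 z)^-1 *: z) v.

Lemma norm1_ge0 t : (forall v, 0 <= t v) -> 0 <= norm1 t.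
Proof. by move=> t0; apply: sumr_ge0. Qed.

Lemma norm1_eq0 t v : (forall v, 0 <= t v) -> norm1 t = 0 -> t v = 0.
Proof. by move=> t0 /eqP; rewrite psumr_eq0// => /allP/(_ v (mem_index_enum v))/eqP. Qed.

Lemma normalizeP t : realization_cone t -> norm1 t != 0 -> GL (normalize t).
Proof.
move=> [t0 tL] t1; split=> [v||].
- by rewrite /normalize mulr_ge0// invr_ge0 norm1_ge0.
- by rewrite /normalize -mulr_sumr mulVf.
- apply: Lsub tL _; apply/fintype.subsetP => v; rewrite !inE.
  by apply: contra_neq => tv; rewrite /normalize tv mulr0.
Qed.

Lemma norm2_sqr z : norm2 z ^+ 2 = \sum_i z 0 i ^+ 2.
Proof. by rewrite sqr_sqrtr// sumr_ge0// => i _; rewrite sqr_ge0. Qed.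

Lemma norm2_ge0 z : 0 <= norm2 z.
Proof. exact: sqrtr_ge0. Qed.

Lemma norm2_eq0 z : norm2 z = 0 -> z = 0.
Proof.
move=> z0; have /eqP := norm2_sqr z; rewrite z0 expr0n/= eq_sym psumr_eq0; last first.
  by move=> i _; rewrite sqr_ge0.
move=> /allP z00; apply/matrixP => i j; rewrite mxE ord1.
by have := z00 j (mem_index_enum j); rewrite sqrf_eq0 => /eqP.
Qed.

Lemma norm2_0 : norm2 0 = 0.
Proof.
apply/eqP; rewrite -sqrf_eq0 norm2_sqr big1// => i _.
by rewrite mxE expr0n.
Qed.

Lemma norm2Z a z : 0 <= a -> norm2 (a *: z) = a * norm2 z.
Proof.
move=> a0; apply/eqP; rewrite -(@eqrXn2 _ 2)// ?norm2_ge0 ?mulr_ge0 ?norm2_ge0//.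
rewrite norm2_sqr exprMn norm2_sqr mulr_sumr; apply/eqP/eq_bigr => i _.
by rewrite mxE exprMn.
Qed.

Lemma sphereP z : S z <-> norm2 z = 1.
Proof.
split=> [Sz|z1]; first by rewrite /norm2 Sz sqrtr1.
by rewrite /unit_sphere/= -norm2_sqr z1 expr1n.
Qed.

Lemma normalize2P z : norm2 z != 0 -> S ((norm2 z)^-1 *: z).
Proof.
by move=> z0; apply/sphereP; rewrite norm2Z ?invr_ge0 ?norm2_ge0// mulVf.
Qed.

Lemma sphere_coord_le1 z i : S z -> `|z 0 i| <= 1.
Proof.
move=> Sz; rewrite -(@expr_le1 _ 2)// -normrX ger0_norm ?sqr_ge0// -Sz.
by rewrite (bigD1 i)//= lerDl sumr_ge0// => j _; rewrite sqr_ge0.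
Qed.

Lemma cone_invP z : realization_cone (cone_inv z).
Proof.
have [z0|z0] := eqVneq (norm2 z) 0.
  split=> [v|]; first by rewrite /cone_inv z0 mul0r.
  suff -> : supp (cone_inv z) = finset.set0 by [].
  by apply/setP => v; rewrite !inE /cone_inv z0 mul0r eqxx.
have [gz0 _ gzL] := gGL (normalize2P z0); split=> [v|].
  by rewrite mulr_ge0 ?norm2_ge0.
apply: Lsub gzL _; apply/fintype.subsetP => v; rewrite !inE.
by apply: contra_neq => gv; rewrite /cone_inv gv mulr0.
Qed.

Lemma cone_mapK t : realization_cone t -> cone_inv (cone_map t) = t.
Proof.
move=> Ct; have [t0 _] := Ct; apply: funext => v; rewrite /cone_inv.
have [t1|t1] := eqVneq (norm1 t) 0.
  by rewrite /cone_map t1 scale0r norm2_0 mul0r norm1_eq0.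
have /sphereP Sh := hS (normalizeP Ct t1).
rewrite /cone_map norm2Z ?norm1_ge0// Sh mulr1.
rewrite scalerA mulVf// scale1r hK; last exact: normalizeP.
by rewrite /normalize mulrA divff// mul1r.
Qed.

Lemma cone_invK z : cone_map (cone_inv z) = z.
Proof.
have [z0|z0] := eqVneq (norm2 z) 0.
  rewrite (norm2_eq0 z0) /cone_map /norm1 big1 ?scale0r// => v _.
  by rewrite /cone_inv norm2_0 mul0r.
have [gz0 gz1 _] := gGL (normalize2P z0).
have z1 : norm1 (cone_inv z) = norm2 z by rewrite /norm1 -mulr_sumr gz1 mulr1.
have nz : normalize (cone_inv z) = g ((norm2 z)^-1 *: z).
  by apply: funext => v; rewrite /normalize z1 /cone_inv mulrA mulVf// mul1r.
rewrite /cone_map nz z1 gK; last exact: normalize2P.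
by rewrite scalerA divff// scale1r.
Qed.

Lemma norm2_cont : continuous norm2.
Proof.
move=> z; apply: (@cvg_comp _ _ _ (fun z => \sum_i z 0 i ^+ 2) Num.sqrt _
  (nbhs (\sum_i z 0 i ^+ 2))); last exact: sqrt_continuous.
apply: (@sum_cvg R _ (nbhs z) _ _ _ _ (fun i (z : 'rV[R]_d.+1) => z 0 i ^+ 2)) => i.
have ci := @coord_cvg _ R 1 d.+1 id (nbhs z) (nbhs_filter z) z 0 i (@cvg_id _ _).
exact: (cvgM ci ci).
Qed.

(** At the apex the values of [g] need not converge, but barycentric coordinates lie between 0 and
    1, so the factor [norm2] squeezes the product to 0. *)
Lemma cone_inv_cont v : continuous (fun z => cone_inv z v).
Proof.
move=> z; have [z0|z0] := eqVneq (norm2 z) 0.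
  have cz : cone_inv z v = 0 by rewrite /cone_inv z0 mul0r.
  rewrite /continuous_at cz.
  apply: (@squeeze_cvgr _ (nbhs z) (nbhs_filter z) R (fun=> 0) norm2).
  - apply: nearW => y; have [/(_ v) -> _ /=] := cone_invP y.
    rewrite /cone_inv; have [->|y0] := eqVneq (norm2 y) 0; first by rewrite mul0r.
    have [g0 g1 _] := gGL (normalize2P y0).
    rewrite -[leRHS]mulr1 ler_wpM2l ?norm2_ge0// -g1 (bigD1 v)//= lerDl.
    exact: sumr_ge0.
  - exact: cvg_cst.
  - by rewrite -z0; exact: norm2_cont.
have nz : \forall y \near z, norm2 y != 0.
  have : nbhs (norm2 z) [set r : R | r != 0].
    by apply: open_nbhs_nbhs; split=> //; exact: open_neq.
  exact: norm2_cont.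
have cn : (norm2 y)^-1 *: y @[y --> z] --> (norm2 z)^-1 *: z.
  by apply: (@cvgZ _ _ _ (nbhs z)) => //; apply: cvgV => //; exact: norm2_cont.
apply: (@cvgM _ _ (nbhs z)); first exact: norm2_cont.
apply: (@ptws_cvgP _ _ _ (nbhs z) _ (fun y => g ((norm2 y)^-1 *: y)) _).1.
apply: (cvg_within_comp (g := fun y => (norm2 y)^-1 *: y) g_cont) => //.
  exact: normalize2P.
by apply: filterS nz => y; exact: normalize2P.
Qed.

(** The cone on the simplicial map from |L| to the simplex induced by [f], the cone on the simplex
    being read as the orthant. *)
Definition sphere_retraction z : 'rV[R]_n.+1 := \row_i \sum_(v | f v == i) cone_inv z v.

Lemma sphere_retraction_cont : continuous sphere_retraction.
Proof.
move=> z; apply/(@mx_cvgP _ _ _ _ _ (nbhs z)) => i j; rewrite mxE.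
under eq_fun do rewrite mxE.
by apply: (@sum_cvg _ _ (nbhs z) _ _ _ _ (fun v z => cone_inv z v)) => v;
  exact: cone_inv_cont.
Qed.

(** A section of the folding over the cone on [J]: colors are distinct on a simplex of [L], so each
    vertex can take the coordinate of its color. *)
Definition simplex_lift J (y : 'rV[R]_n.+1) : {ptws V -> R} :=
  fun v => if v \in J then y 0 (f v) else 0.

Definition sphere_chart J y : 'rV[R]_d.+1 := cone_map (simplex_lift J y).

Local Notation Kf J := (@chamber_face R n (~: (f @: J))).

Lemma supp_simplex_lift J y : supp (simplex_lift J y) =
  [set v in J | f v \notin zeros y]%SET.
Proof.
apply/setP => v; rewrite !inE /simplex_lift; case: ifP => _ //=.
by rewrite eqxx.
Qed.

Lemma simplex_liftP J y : J \in L -> Kf J y -> realization_cone (simplex_lift J y).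
Proof.
move=> JL [y0 _]; split=> [v|]; first by rewrite /simplex_lift; case: ifP.
apply: Lsub JL _; rewrite supp_simplex_lift.
by apply/fintype.subsetP => v; rewrite inE => /andP[].
Qed.

Lemma simplex_liftK J y i : J \in L -> Kf J y ->
  \sum_(v | f v == i) simplex_lift J y v = y 0 i.
Proof.
move=> JL [_ /fintype.subsetP yJ].
have [/imsetP[v vJ ->{i}]|iJ] := boolP (i \in f @: J).
  rewrite (bigD1 v)//= big1 ?addr0 => [|w /andP[/eqP fw wv]].
    by rewrite /simplex_lift vJ.
  rewrite /simplex_lift; case: ifP => // wJ.
  by rewrite (finj JL wJ vJ fw) eqxx in wv.
rewrite big1 => [|v /eqP fv].
  by apply/esym/eqP; have := yJ i; rewrite !inE; apply.
rewrite /simplex_lift; case: ifP => // vJ.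
by move: iJ; rewrite -fv imset_f.
Qed.

Lemma sphere_chartK J y : J \in L -> Kf J y -> sphere_retraction (sphere_chart J y) = y.
Proof.
move=> JL yJ; apply/matrixP => a i; rewrite ord1 mxE.
by rewrite cone_mapK; [exact: simplex_liftK|exact: simplex_liftP].
Qed.

(** The simplex supporting the barycentric coordinates of [z] works: on it every color sum has at
    most one nonzero term, so nothing is lost by folding. *)
Lemma sphere_chart_surj z : exists2 J, J \in L &
  Kf J (sphere_retraction z) /\ sphere_chart J (sphere_retraction z) = z.
Proof.
have [z0 zL] := cone_invP z; set J := supp _ in zL; exists J => //.
have zJ v : v \notin J -> cone_inv z v = 0 by rewrite inE negbK => /eqP.
have zv v : v \in J -> sphere_retraction z 0 (f v) = cone_inv z v.
  move=> vJ; rewrite mxE (bigD1 v)//= big1 ?addr0// => w /andP[/eqP fw wv].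
  apply: zJ; apply: contra wv => wJ; apply/eqP; exact: (finj zL wJ vJ fw).
split; first split.
- by move=> i; rewrite mxE sumr_ge0.
- apply/fintype.subsetP => i; rewrite !inE => iJ; rewrite mxE big1// => v /eqP fv.
  by apply: zJ; apply: contra iJ => vJ; rewrite -fv imset_f.
- rewrite -[RHS]cone_invK; congr cone_map; apply: funext => v.
  by rewrite /simplex_lift; case: ifPn => [/zv|/zJ].
Qed.

(** The cone map is injective, and a lift of [y] takes the value of [y] at the color of v wherever
    it is nonzero; it is therefore determined by its support. *)
Lemma sphere_chart_eq J J' y : J \in L -> J' \in L -> Kf J y -> Kf J' y ->
  sphere_chart J y = sphere_chart J' y <->
  [set v in J | f v \notin zeros y]%SET = [set v in J' | f v \notin zeros y]%SET.
Proof.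
move=> JL JL' yJ yJ'; rewrite -!supp_simplex_lift; split=> E.
  by rewrite -(cone_mapK (simplex_liftP JL yJ)) -(cone_mapK (simplex_liftP JL' yJ'))
    -!/(sphere_chart _ _) E.
congr cone_map; apply: funext => v; move/setP: E => /(_ v).
rewrite !inE /simplex_lift; case: ifP => _; case: ifP => _ //.
  by rewrite eqxx => /negbT; rewrite negbK => /eqP.
by rewrite eqxx => /esym/negbT; rewrite negbK => /eqP.
Qed.

Lemma sphere_chart_cont J : J \in L -> {within Kf J, continuous sphere_chart J}.
Proof.
move=> JL; apply/subspace_continuousP => y yJ.
set W := within _ _; have FW : Filter W by exact: within_filter.
have WJ : \forall x \near W, Kf J x by apply: (@filterE _ (nbhs y)).
have WN : id @ W --> y by exact: cvg_within.
have cl v : simplex_lift J x v @[x --> W] --> simplex_lift J y v.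
  rewrite /simplex_lift; case: ifP => _; last exact: cvg_cst.
  exact: coord_cvg.
have cn : norm1 (simplex_lift J x) @[x --> W] --> norm1 (simplex_lift J y).
  by apply: (@sum_cvg _ _ W _ _ _ _ (fun v x => simplex_lift J x v)).
(* At the apex the direction given by [h] is uncontrolled but bounded, being a unit vector, while
   the factor [norm1] tends to 0. *)
have [y0|y0] := eqVneq (norm1 (simplex_lift J y)) 0.
  have E0 : sphere_chart J y = 0 by rewrite /sphere_chart /cone_map y0 scale0r.
  change (sphere_chart J @ W --> sphere_chart J y); rewrite E0.
  apply/mx_cvgP => a i; rewrite ord1 mxE; apply/norm_cvg0P.
  apply: (@squeeze_cvgr _ _ _ _ (fun=> 0) (fun x => norm1 (simplex_lift J x))).
  - apply: filterS WJ => x xJ; rewrite normr_ge0/= /sphere_chart /cone_map mxE normrM.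
    have Cx := simplex_liftP JL xJ; have [x0 _] := Cx.
    rewrite (ger0_norm (norm1_ge0 x0)).
    have [->|nx] := eqVneq (norm1 (simplex_lift J x)) 0; first by rewrite mul0r.
    rewrite -[leRHS]mulr1 ler_wpM2l ?norm1_ge0//.
    by apply: sphere_coord_le1; exact/hS/normalizeP.
  - exact: cvg_cst.
  - by rewrite -y0.
apply: (@cvgZ _ _ _ W) => //.
have WN0 : \forall x \near W, norm1 (simplex_lift J x) != 0.
  have : nbhs (norm1 (simplex_lift J y)) [set r : R | r != 0].
    by apply: open_nbhs_nbhs; split=> //; exact: open_neq.
  exact: cn.
apply: (cvg_within_comp (g := fun x => normalize (simplex_lift J x)) h_cont).
- by apply: normalizeP => //; exact: simplex_liftP.
- by apply/ptws_cvgP => v; apply: cvgM => //; exact: cvgV.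
- apply: filterS2 WJ WN0 => x xJ x0.
  by apply: normalizeP => //; exact: simplex_liftP.
Qed.

End SphereModel.

(** * Pullbacks *)

Section PullbackManifold.
Variables (R : realType) (n k : nat) (V : finType) (L : {set {set V}}).
Variables (f : V -> 'I_n.+1) (M : topologicalType) (F : 'I_n.+1 -> set M).
Hypothesis sphereL : triangulates_a_sphere R L.
Hypothesis colorL : coloring L f.
Hypothesis Fcl : forall i, closed (F i).
Hypothesis F_ex : face F [set: 'I_n.+1]%SET !=set0.
Hypothesis M_hausdorff : hausdorff_space M.
Hypothesis M_second : @second_countable M.
Hypothesis M_compact : compact [set: M].
Hypothesis M_chart : forall x, exists (U : set M) (psi : M -> 'rV[R]_(n.+1 + k)),
  U x /\ colored_chart F U psi.

Local Notation Q := (pullback L f F).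
Local Notation simplex := {J : {set V} | J \in L}.
Implicit Types (J : simplex) (x : M).

Definition pullback_face J : {set 'I_n.+1} := ~: (f @: val J).

(* The smallest simplex whose piece contains a point [x] of the piece of [J] with
   [faces_at F x = K]: two pieces are glued at [x] iff they have it in common. *)
Definition visible (K : {set 'I_n.+1}) J : {set V} :=
  [set v in val J | f v \notin K]%SET.

Definition same_visible (K : {set 'I_n.+1}) : rel simplex :=
  fun J J' => visible K J == visible K J'.

Lemma pullback_step_visible (p q : pullback_prespace L f F) : pullback_step p q ->
  visible (faces_at F (set_val (projT2 p))) (projT1 p) =
  visible (faces_at F (set_val (projT2 q))) (projT1 q).
Proof.
case: p => J [x xJ]; case: q => J' u [/= JJ' xu].
rewrite -xu set_valE/= {xu}.
move: xJ; rewrite inE => /faceP xJ.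
apply/setP => v; rewrite !inE; case vJ: (v \in val J) => /=.
  by rewrite (fintype.subsetP JJ').
case vJ': (v \in val J') => //=; apply/esym/negbTE; rewrite negbK.
suff : f v \in faces_at F x by rewrite inE.
apply: (fintype.subsetP xJ); rewrite inE; apply/negP => /imsetP[w wJ fvw].
have [finj _] := colorL.
have wJ' : w \in val J' by exact: (fintype.subsetP JJ').
by move: vJ; rewrite (finj _ (valP J') v w vJ' wJ' fvw) wJ.
Qed.

Lemma pullback_rel_visible (p q : pullback_prespace L f F) :
  clos_refl_sym_trans _ (@pullback_step n V L f M F) p q ->
  set_val (projT2 p) = set_val (projT2 q) /\
  visible (faces_at F (set_val (projT2 p))) (projT1 p) =
  visible (faces_at F (set_val (projT2 q))) (projT1 q).
Proof.
elim=> {p q} [p q pq|p|p q _ [-> ->]|p q r _ [-> ->] _ [-> ->]] //.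
by split; [case: pq|exact: pullback_step_visible].
Qed.

Definition pullback_pi (p : pullback_prespace L f F) : Q :=
  \pi_({eq_quot (pullback_equiv L f F)})%qT p.

Lemma pullback_piE p q : pullback_pi p = pullback_pi q <->
  clos_refl_sym_trans _ (@pullback_step n V L f M F) p q.
Proof. by split=> [/eqmodP/asboolP|pq]; [|apply/eqmodP/asboolP]. Qed.

Definition piece_point J x (Jx : face F (pullback_face J) x) : pullback_prespace L f F :=
  existT _ J (exist _ x (mem_set Jx) : pullback_piece f F J).

Lemma pullback_nonempty : exists c : Q, True.
Proof.
have [x xF] := F_ex; have [[L0 _ _] _] := sphereL.
have Jx : face F (pullback_face (exist _ finset.set0 L0)) x.
  by move=> i _; apply: xF; rewrite /= inE.
by exists (pullback_pi (piece_point Jx)).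
Qed.

(* The value is junk when [x] is outside the face belonging to [J]. *)
Definition pullback_point J x : Q :=
  match pselect (face F (pullback_face J) x) with
  | left Jx => pullback_pi (piece_point Jx)
  | right _ => sval (cid pullback_nonempty) end.

Lemma pullback_pointE J x (Jx : face F (pullback_face J) x) :
  pullback_point J x = pullback_pi (piece_point Jx).
Proof.
by rewrite /pullback_point; case: pselect => // Jx'; rewrite (Prop_irrelevance Jx' Jx).
Qed.

Lemma pullback_point_pi J (u : pullback_piece f F J) :
  pullback_pi (existT _ J u) = pullback_point J (set_val u) /\
  face F (pullback_face J) (set_val u).
Proof.
case: u => x xJ; have Jx : face F (pullback_face J) x by move: xJ; rewrite inE.
split=> //; rewrite set_valE/= (pullback_pointE Jx); congr pullback_pi.
by rewrite /piece_point; congr existT; congr exist; exact: Prop_irrelevance.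
Qed.

Lemma pullback_point_eq J J' x x' :
  face F (pullback_face J) x -> face F (pullback_face J') x' ->
  pullback_point J x = pullback_point J' x' <->
  x = x' /\ same_visible (faces_at F x) J J'.
Proof.
move=> Jx Jx'; rewrite (pullback_pointE Jx) (pullback_pointE Jx') pullback_piE.
split=> [/pullback_rel_visible[/=]|[xx' /eqP JJ']].
  by rewrite !set_valE/= => <- E; split=> //; apply/eqP.
rewrite -{x'}xx' in Jx' *; have [[_ _ Lsub] _] := sphereL.
have KL : visible (faces_at F x) J \in L.
  by apply: Lsub (valP J) _; apply/fintype.subsetP => v; rewrite inE => /andP[].
pose K : simplex := exist _ (visible (faces_at F x) J) KL.
(* Colors outside the image of [J] contain [x] by [Jx], and colors of invisible vertices by
   definition. Both points are then glued to the copy of [x] in the piece of [K]. *)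
have Kx : face F (pullback_face K) x.
  apply/faceP/fintype.subsetP => i; rewrite inE => iK; apply/negPn/negP => ix.
  move/faceP/fintype.subsetP: Jx => /(_ i); rewrite inE => Jx.
  have : i \in f @: val J by apply/negPn/negP => /Jx; apply/negP.
  move=> /imsetP[v vJ iE]; move: iK; rewrite iE imset_f// inE vJ/=.
  by rewrite -iE.
have vs J0 : visible (faces_at F x) J0 \subset val J0.
  by apply/fintype.subsetP => v; rewrite inE => /andP[].
have KJ' : visible (faces_at F x) J \subset val J' by rewrite JJ'.
apply: (rst_trans _ _ _ (piece_point Kx)); [apply: rst_sym|]; apply: rst_step; split=> //.
exact: vs.
Qed.

Lemma set_type_openP (D : set M) (B : set (set_type D)) :
  open B <-> forall u, B u ->
    \forall y \near set_val u, forall h : y \in D, B (exist _ y h).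
Proof.
split=> [[W oW WB] u Bu|H].
  have : nbhs (set_val u) W by apply: open_nbhs_nbhs; split=> //; move: Bu; rewrite -WB.
  by apply: filterS => y Wy h; rewrite -WB /= set_valE.
exists (\bigcup_(W in [set W | open W /\ set_val @^-1` W `<=` B]) W).
  by apply: bigcup_open => W [].
apply/seteqP; split=> [u [W [_ WB] Wu]|u Bu]; first exact: WB.
have : nbhs (set_val u) [set y | forall h : y \in D, B (exist _ y h)] := H u Bu.
rewrite nbhsE => -[W [oW Wu] WB].
exists W => //; split=> // -[y yD] Wy; apply: WB; exact: Wy.
Qed.

Lemma pullback_point_open (A : set Q) : open A <->
  forall J x, face F (pullback_face J) x -> A (pullback_point J x) ->
    \forall y \near x, face F (pullback_face J) y -> A (pullback_point J y).
Proof.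
have openE' : open A <-> forall J, open (existT _ J @^-1` (pullback_pi @^-1` A)).
  by rewrite -sigT_openP.
rewrite openE'; split=> [oA J x Jx Ax|H J].
  have /set_type_openP/(_ (exist _ x (mem_set Jx))) := oA J.
  rewrite /= -/(piece_point Jx) -pullback_pointE => /(_ Ax).
  rewrite set_valE/=; apply: filterS => y Ay Jy.
  by rewrite (pullback_pointE Jy); exact: Ay.
apply/set_type_openP => u Au; have [uE Ju] := pullback_point_pi u.
rewrite /= uE in Au; have := H J _ Ju Au; apply: filterS => y Ay h.
have [hE Jh] := pullback_point_pi (exist _ y h : pullback_piece f F J).
by rewrite /= hE; apply: Ay.
Qed.

Lemma pullback_manifold : closed_manifold R Q.
Proof.
have [[L0 _ Lsub] [d [h [g [[hS gGL] [hK gK] h_cont g_cont]]]]] := sphereL.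
have [finj _] := colorL.
apply: (@glue_closed_manifold R n k d.+1 M Q F simplex pullback_face same_visible
  pullback_point (fun J => sphere_chart f h (val J)) (sphere_retraction f g)) => //.
- move=> K K' J J' KK' /eqP/setP JJ'; apply/eqP/setP => v; have := JJ' v.
  rewrite !inE; case vK': (f v \in K'); first by rewrite !andbF.
  by rewrite (contraNN (fintype.subsetP KK' _)) ?vK'.
- move=> c; case: (repr c) (reprK c) => J u cE.
  have [uE Ju] := pullback_point_pi u.
  by exists J, (set_val u); split=> //; rewrite -uE.
- exact: pullback_point_eq.
- exact: pullback_point_open.
- by move=> J; exact: (sphere_chart_cont Lsub hS h_cont (valP J)).
- exact: (sphere_retraction_cont L0 Lsub gGL g_cont).
- by move=> J y; exact: (sphere_chartK Lsub finj hS hK (valP J)).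
- move=> z; have [J JL Jz] := sphere_chart_surj L0 Lsub finj gGL gK z.
  by exists (exist _ J JL).
- move=> J J' y yJ yJ'; rewrite (sphere_chart_eq Lsub hS hK (valP J) (valP J'))//.
  by split=> /eqP.
Qed.

End PullbackManifold.

(** * Straightening corners *)

(** The complements of the domain and of the image have equal cardinality; their enumerations are
    matched in order. *)
Lemma bij_extension (S T : finType) (D : {set S}) (f : S -> T) :
  #|S| = #|T| -> {in D &, injective f} ->
  exists e e', [/\ cancel e e', cancel e' e & {in D, e =1 f}].
Proof.
move=> cST finj.
pose sS := enum (~: D); pose sT := enum (~: (f @: D)).
have szE : size sS = size sT.
  rewrite -!cardE; apply/eqP; rewrite -(eqn_add2l #|D|) cardsC.
  by rewrite -(card_in_imset finj) cardsC cST.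
pose e x := if x \in D then f x else nth (f x) sT (index x sS).
have idx x : x \notin D -> (index x sS < size sT)%N.
  by move=> xD; rewrite -szE index_mem mem_enum inE.
have eN x : x \notin D -> e x \notin f @: D.
  move=> xD; rewrite /e (negPf xD).
  have : nth (f x) sT (index x sS) \in sT by apply: mem_nth; exact: idx.
  by rewrite mem_enum inE.
have einj : injective e.
  move=> x y; have [xD|xD] := boolP (x \in D); have [yD|yD] := boolP (y \in D).
  - by rewrite /e xD yD; exact: finj.
  - by move=> exy; have := eN _ yD; rewrite -exy /e xD imset_f.
  - by move=> exy; have := eN _ xD; rewrite exy /e yD imset_f.
  - rewrite /e (negPf xD) (negPf yD) (set_nth_default (f x) (f y)) ?idx//.
    move=> /eqP; rewrite nth_uniq ?idx ?enum_uniq// => /eqP ixy.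
    rewrite -[x](@nth_index _ x x sS) ?mem_enum ?inE// ixy nth_index//.
    by rewrite mem_enum inE.
have [e' eK e'K] := inj_card_bij einj (eq_leq (esym cST)).
by exists e, e'; split=> // x xD; rewrite /e xD.
Qed.

Lemma bigminDr (R : realType) (I : Type) (r : seq I) (P : pred I) (x c : R) (F : I -> R) :
  \big[Num.min/x + c]_(i <- r | P i) (F i + c) = \big[Num.min/x]_(i <- r | P i) F i + c.
Proof.
elim: r => [|i r IHr]; first by rewrite !big_nil.
by rewrite !big_cons IHr; case: (P i) => //; rewrite addr_minl.
Qed.

Section Straightening.
Variables (R : realType) (m n k : nat).
Variables (Z : {set 'I_m}) (tau : 'I_m -> 'I_n.+1) (eps : R) (v0 : 'rV[R]_m).
Hypothesis mE : (n.+1 + k = m)%N.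
Hypothesis eps0 : 0 < eps.
Hypothesis v0Z : forall a, a \in Z -> v0 0 a = 0.
Hypothesis v0NZ : forall a, a \notin Z -> eps <= v0 0 a.
Implicit Types (a b : 'I_m) (i : 'I_n.+1) (v : 'rV[R]_m) (y : 'rV[R]_(n.+1 + k)).

Definition rep_opt i : option 'I_m := [pick b | (b \in Z) && (tau b == i)].
Definition rep a : 'I_m := odflt a (rep_opt (tau a)).

Lemma repP a : a \in Z -> rep a \in Z /\ tau (rep a) = tau a.
Proof.
move=> aZ; rewrite /rep /rep_opt; case: pickP => [b /andP[bZ /eqP ->]//|/(_ a)].
by rewrite aZ eqxx.
Qed.

Lemma rep_eq a b : a \in Z -> tau a = tau b -> rep a = rep b.
Proof.
move=> aZ ab; rewrite /rep -ab /rep_opt; case: pickP => // /(_ a).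
by rewrite aZ eqxx.
Qed.

(** Coordinate [i] among the first n+1 has to be the representative of color [i]. A color with no
    hyperplane through the corner gets some leftover coordinate, which after straightening is
    positive nearby. *)
Lemma straightening_index : exists
    (e : 'I_(n.+1 + k) -> 'I_m) (e' : 'I_m -> 'I_(n.+1 + k)),
  [/\ cancel e e', cancel e' e &
      forall i b, rep_opt i = Some b -> e (lshift k i) = b].
Proof.
pose D : {set 'I_(n.+1 + k)} := [set lshift k i | i : 'I_n.+1 & rep_opt i != None]%SET.
pose f (c : 'I_(n.+1 + k)) : 'I_m := match fintype.split c with
  | inl i => odflt (cast_ord mE c) (rep_opt i) | inr _ => cast_ord mE c end.
have fD i b : rep_opt i = Some b -> f (lshift k i) = b.
  move=> ib; rewrite /f; case: fintype.splitP => [j ij|j ij] /=.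
    by have -> : j = i by [apply: val_inj]; rewrite ib.
  by have := ltn_ord i; rewrite [X in (X < _)%N]ij ltnNge leq_addr.
have [||e [e' [eK e'K eD]]] := @bij_extension _ _ D f.
- by rewrite !card_ord.
- move=> c c' /imsetP[i]; rewrite inE; case Ei: (rep_opt i) => [b|//] _ ->.
  move=> /imsetP[i']; rewrite inE; case Ei': (rep_opt i') => [b'|//] _ ->.
  rewrite (fD _ _ Ei) (fD _ _ Ei') => bb'; congr lshift.
  move: Ei Ei'; rewrite /rep_opt; case: pickP => // c1 /andP[_ /eqP <-] [->].
  by case: pickP => // c2 /andP[_ /eqP <-] [->]; rewrite bb'.
exists e, e'; split=> // i b ib; rewrite eD ?(fD _ _ ib)//.
by apply/imsetP; exists i; rewrite // inE ib.
Qed.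

(* A color [i] may occur on several hyperplanes [v_a = 0] through the corner (M_i
   may itself have corners).  The quadrant they span is bent open along its
   diagonal: the coordinate of one representative becomes the minimum, the others
   their difference to it, which [eps] makes positive near [v0]. *)
Definition straighten v : 'rV[R]_m := \row_a
  if a \in Z then
    if a == rep a then \big[Num.min/v 0 a]_(b | (b \in Z) && (tau b == tau a)) v 0 b
    else v 0 a - v 0 (rep a) + eps
  else v 0 a.

(** Recovers from straightened coordinates the original difference to the representative, which was
    stored with [eps] added. *)
Definition bend_offset v b : R := if b == rep b then 0 else v 0 b - eps.

(** If o_b are the differences to the representative, the stored minimum is v_rep + min o_b, so v_a
    is this minimum plus o_a - min o_b. The default 0 is harmless: it is the offset of the
    representative. *)
Definition bend v : 'rV[R]_m := \row_a
  if a \in Z then v 0 (rep a) + bend_offset v a -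
    \big[Num.min/0]_(b | (b \in Z) && (tau b == tau a)) bend_offset v b
  else v 0 a.

Lemma rep_id a : a \in Z -> rep (rep a) = rep a.
Proof. by move=> aZ; have [rZ ra] := repP aZ; exact: rep_eq. Qed.

Lemma straightenK : cancel straighten bend.
Proof.
move=> v; apply/matrixP => z a; rewrite {z}ord1 mxE; case: ifP => aZ; last first.
  by rewrite mxE aZ.
have off b : b \in Z -> tau b = tau a ->
    bend_offset (straighten v) b = v 0 b - v 0 (rep a).
  move=> bZ ba; have rb := rep_eq bZ ba; rewrite /bend_offset -rb.
  case: eqVneq => [<-|br]; first by rewrite subrr.
  by rewrite mxE bZ (negPf br) addrK.
have [rZ ra] := repP aZ.
rewrite off// mxE rZ rep_id// eqxx ra.
under [X in _ - X]eq_bigr => b /andP[bZ /eqP ba] do rewrite off//.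
rewrite -[X in \big[_/X]_(_ | _) (_ - _)](subrr (v 0 (rep a))) bigminDr.
by ring.
Qed.

Lemma bendK : cancel bend straighten.
Proof.
move=> v; apply/matrixP => z a; rewrite {z}ord1 mxE; case: ifP => aZ; last first.
  by rewrite mxE aZ.
set w := \big[Num.min/0]_(b | (b \in Z) && (tau b == tau a)) bend_offset v b.
have bE b : b \in Z -> tau b = tau a -> bend v 0 b = bend_offset v b + (v 0 (rep a) - w).
  by move=> bZ ba; rewrite mxE bZ (rep_eq bZ ba) ba -/w; ring.
have [rZ ra] := repP aZ.
have ro : bend_offset v (rep a) = 0 by rewrite /bend_offset rep_id// eqxx.
case: (eqVneq a (rep a)) => [ar|ar].
  under eq_bigr => b /andP[bZ /eqP ba] do rewrite bE//.
  have oa : bend_offset v a = 0 by rewrite /bend_offset -ar eqxx.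
  rewrite bE// bigminDr oa -/w -ar; ring.
by rewrite !bE// ro /bend_offset (negPf ar); ring.
Qed.

Lemma straighten_cont : continuous straighten.
Proof.
move=> v; apply/(@mx_cvgP _ _ _ _ _ (nbhs v)) => z a; rewrite {z}ord1 mxE.
under eq_fun do rewrite mxE.
have c b : (w 0 b @[w --> v]) --> v 0 b.
  exact: (@coord_cvg _ R 1 m id (nbhs v) (nbhs_filter v) v 0 b (@cvg_id _ _)).
case: (a \in Z); last exact: c.
case: (a == rep a).
  apply: (@bigmin_cvg R _ (nbhs v) _ _ _ _ (fun w : 'rV[R]_m => w 0 a)
    (fun b w => w 0 b)) => [|b]; exact: c.
apply: (@cvgD _ _ _ (nbhs v)); last exact: cvg_cst.
by apply: (@cvgB _ _ _ (nbhs v)); exact: c.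
Qed.

Lemma bend_cont : continuous bend.
Proof.
move=> v; apply/(@mx_cvgP _ _ _ _ _ (nbhs v)) => z a; rewrite {z}ord1 mxE.
under eq_fun do rewrite mxE.
have c b : (w 0 b @[w --> v]) --> v 0 b.
  exact: (@coord_cvg _ R 1 m id (nbhs v) (nbhs_filter v) v 0 b (@cvg_id _ _)).
have co b : (bend_offset w b @[w --> v]) --> bend_offset v b.
  rewrite /bend_offset; case: (b == rep b) => /=.
    exact: (@cvg_cst _ (0 : R) _ (nbhs v)).
  apply: (@cvgB _ _ _ (nbhs v) _ (fun w : 'rV[R]_m => w 0 b) (fun=> eps)).
    exact: c.
  exact: cvg_cst.
case: (a \in Z); last exact: c.
apply: (@cvgB _ _ _ (nbhs v)).
  by apply: (@cvgD _ _ _ (nbhs v)); [exact: c|exact: co].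
apply: (@bigmin_cvg R _ (nbhs v) _ _ _ _ (fun _ => 0) (fun b w => bend_offset w b)).
  exact: cvg_cst.
exact: co.
Qed.

Lemma ball_pos v a : ball v0 eps v -> a \notin Z -> 0 < v 0 a.
Proof.
move=> [_ /(_ 0 a)]; rewrite /ball/= => va /v0NZ v0a.
have := ler_norm (v0 0 a - v 0 a); lra.
Qed.

(** For a nonrepresentative in [Z], the coordinate at [rep a] is below [eps] in the ball, as it
    vanishes at the center, and that at [a] is nonnegative. Such coordinates impose no local
    constraint. *)
Lemma straighten_pos v a : @orthant R m v -> ball v0 eps v ->
  a \notin Z \/ a != rep a -> 0 < straighten v 0 a.
Proof.
move=> v_ge0 vB; rewrite mxE; case: ifPn => [aZ|aZ _]; last exact: ball_pos.
case=> // /negPf ->; have [rZ _] := repP aZ.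
have [_ /(_ 0 (rep a))] := vB; rewrite /ball/= v0Z// sub0r normrN => vr.
have := ler_norm (v 0 (rep a)); have := v_ge0 a; lra.
Qed.

(** A minimum of nonnegative numbers vanishes iff one of them does: the union of the hyperplanes of
    one color becomes a single coordinate hyperplane. *)
Lemma straighten_rep v a : @orthant R m v -> a \in Z -> a == rep a ->
  0 <= straighten v 0 a /\
  (straighten v 0 a = 0 <-> exists b, [/\ b \in Z, tau b = tau a & v 0 b = 0]).
Proof.
move=> v_ge0 aZ ar; rewrite mxE aZ ar.
set mu := \big[_/_]_(_ | _) _.
have mu_le b : b \in Z -> tau b = tau a -> mu <= v 0 b.
  by move=> bZ ba; apply: bigmin_le_cond; rewrite bZ ba eqxx.
have [b [bZ ba bE]] : exists b, [/\ b \in Z, tau b = tau a & mu = v 0 b].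
  apply: (big_ind (fun x => exists b, [/\ b \in Z, tau b = tau a & x = v 0 b])).
  - by exists a.
  - move=> x y [b1 [? ? ->]] [b2 [? ? ->]].
    by case: (leP (v 0 b1) (v 0 b2)) => _; [exists b1|exists b2].
  - by move=> b /andP[bZ /eqP ba]; exists b.
split; first by rewrite bE.
split=> [mu0|[c [cZ ca c0]]]; first by exists b; split=> //; rewrite -bE.
by apply/eqP; rewrite eq_le bE v_ge0 -bE -c0 mu_le.
Qed.

Lemma bend_ge0 v : (forall a, a \in Z -> a == rep a -> 0 <= v 0 a) ->
  ball v0 eps (bend v) -> @orthant R m (bend v).
Proof.
move=> v_ge0 vB a; have [aZ|aZ] := boolP (a \in Z); last first.
  by apply/ltW; exact: ball_pos.
rewrite mxE aZ -addrA addr_ge0//.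
  by have [rZ _] := repP aZ; apply: v_ge0 => //; rewrite rep_id.
rewrite subr_ge0; apply: bigmin_le_cond; by rewrite aZ eqxx.
Qed.

End Straightening.

(** * Local colorings *)

Section LocalColoring.
Variables (R : realType) (m n : nat) (M : topologicalType).
Variables (A : manifold_with_corners R m M) (F : 'I_n.+1 -> set M).
Hypothesis cornerF : corner_of_manifolds A F.
Hypothesis boundaryF : mwc_boundary A `<=` \bigcup_(i in [set: 'I_n.+1]) F i.
Implicit Types (v : 'rV[R]_m) (a b : 'I_m) (i j : 'I_n.+1).

Lemma corner_closed i : closed (F i).
Proof. by have [[]] := cornerF. Qed.

Lemma zero_coordinatesE v : zero_coordinates v = #|zeros v|.
Proof. by rewrite /zero_coordinates /zeros cardsE. Qed.

Lemma face_stratum (J : {set 'I_n.+1}) y : face F J y -> exists z,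
  [/\ codim_set A #|J| z, closure (connected_component (codim_set A #|J|) z) y &
      closure (connected_component (codim_set A #|J|) z) `<=` face F J].
Proof.
have [_ /(_ J)[D DS FJ]] := cornerF; rewrite FJ => -[E DE Ey].
have [_ [z zJ ->] EE] := DS _ DE; exists z; split=> //; first by rewrite -EE.
by move=> u zu; exists E => //; rewrite EE.
Qed.

(** As M_{I(n)} is nonempty, some point has n+1 vanishing coordinates in a chart. *)
Lemma corner_dim_ge : (n.+1 <= m)%N.
Proof.
have [[_ _ /(_ [set: 'I_n.+1]%SET)[y /face_stratum[z [zJ _ _]]]] _] := cornerF.
move: zJ; rewrite cardsT card_ord => -[c [_ _ zc]].
by have := max_card (zeros (c.2 z)); rewrite -zero_coordinatesE zc card_ord.
Qed.

Definition corner_box v0 (eps : R) : set 'rV[R]_m :=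
  [set v | @orthant R m v /\ ball v0 eps v].

Lemma corner_box_chart x : exists (U : set M) (phi : M -> 'rV[R]_m)
    (phi' : 'rV[R]_m -> M) (eps : R),
  [/\ [/\ open U, U x, 0 < eps & forall a, a \notin zeros (phi x) -> eps <= phi x 0 a],
      (forall y, U y -> corner_box (phi x) eps (phi y)) /\
      (forall v, corner_box (phi x) eps v -> U (phi' v)),
      (forall y, U y -> phi' (phi y) = y) /\
      (forall v, corner_box (phi x) eps v -> phi (phi' v) = v),
      {within U, continuous phi} /\ {within corner_box (phi x) eps, continuous phi'} &
      forall y k, U y -> codim_set A k y <-> #|zeros (phi y)| = k].
Proof.
have [[U0 phi] cA /= U0x] := mwc_cover A x.
have [/= oU0 [D oD [phi' [[mU mD] [K1 K2] cphi cphi']]]] := mwc_chart cA.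
set v0 := phi x; have [v0_ge0 Dv0] := mU _ U0x.
have : nbhs v0 D by exact: open_nbhs_nbhs.
move=> /nbhs_ballP[e /= e0 eD].
(* At most [e], so that the chart covers the box, and at most every nonzero coordinate of the
   center, so that only hyperplanes through the center meet the box. *)
pose eps := \big[Num.min/e]_(a | a \notin zeros v0) v0 0 a.
have eps_e : eps <= e by exact: bigmin_le_id.
have eps0 : 0 < eps.
  apply: lt_bigmin => // a; rewrite inE => va.
  by rewrite lt_neqAle eq_sym va; exact: v0_ge0.
have epsD v : corner_box v0 eps v -> (@orthant R m `&` D) v.
  by move=> [v_ge0 vB]; split=> //; apply: eD; exact: le_ball vB.
have U_cont : forall y, U0 y -> phi @ nbhs y --> phi y.
  move=> y Uy; have /subspace_continuousP/(_ y Uy) := cphi.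
  move=> cy W /cy yW; have : nbhs y U0 by exact: open_nbhs_nbhs.
  have {}yW : \forall z \near y, U0 z -> W (phi z) := yW.
  change (nbhs y U0 -> \forall z \near y, W (phi z)).
  by apply: filterS2 yW => z Wz; exact: Wz.
exists (U0 `&` phi @^-1` ball v0 eps), phi, phi', eps; split; [split|split|split|split|].
- rewrite openE => y [Uy yB].
  have nB : nbhs (phi y) (ball v0 eps).
    by apply: open_nbhs_nbhs; split=> //; exact: ball_open.
  have {}nB : nbhs y (phi @^-1` ball v0 eps) := U_cont y Uy _ nB.
  have : nbhs y U0 by exact: open_nbhs_nbhs.
  by move=> yU; exact: filterI.
- by split=> //; exact: ballxx.
- by [].
- by move=> a aZ; apply: bigmin_le_cond.
- by move=> y [Uy yB]; split=> //; have [] := mU _ Uy.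
- by move=> v vB; split; [apply: mD; exact: epsD|rewrite /= K2; [case: vB|exact: epsD]].
- by move=> y [Uy _]; exact: K1.
- by move=> v /epsD; exact: K2.
- by apply: continuous_subspaceW cphi => y [].
- exact: continuous_subspaceW cphi'.
- move=> y k [Uy _]; rewrite -zero_coordinatesE; split=> [[c [c_A cy <-]]|yk].
    exact: (mwc_compatible cA c_A).
  by exists (U0, phi).
Qed.

Section Box.
Variables (x : M) (U : set M) (phi : M -> 'rV[R]_m) (phi' : 'rV[R]_m -> M) (eps : R).
Local Notation B := (corner_box (phi x) eps).
Local Notation Z := (zeros (phi x)).
Hypothesis oU : open U.
Hypothesis Ux : U x.
Hypothesis eps0 : 0 < eps.
Hypothesis gap : forall a, a \notin Z -> eps <= phi x 0 a.
Hypothesis phiB : forall y, U y -> B (phi y).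
Hypothesis phi'U : forall v, B v -> U (phi' v).
Hypothesis phiK : forall y, U y -> phi' (phi y) = y.
Hypothesis phi'K : forall v, B v -> phi (phi' v) = v.
Hypothesis phi_cont : {within U, continuous phi}.
Hypothesis phi'_cont : {within B, continuous phi'}.
Hypothesis codimE : forall y k, U y -> codim_set A k y <-> #|zeros (phi y)| = k.
Implicit Types (y : M).

Lemma near_zeros y : U y -> \forall z \near y, U z /\ zeros (phi z) \subset zeros (phi y).
Proof.
move=> Uy; have nU : nbhs y U by exact: open_nbhs_nbhs.
have phiy : phi @ within U (nbhs y) --> phi y.
  by have /subspace_continuousP/(_ y Uy) := phi_cont.
have H a : \forall z \near y, U z -> a \notin zeros (phi y) -> a \notin zeros (phi z).
  have [az|az] := boolP (a \in zeros (phi y)); first by apply: nearW.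
  have : nbhs (phi y 0 a) [set r : R | r != 0].
    by apply: open_nbhs_nbhs; split; [exact: open_neq|move: az; rewrite inE].
  have FW : Filter (within U (nbhs y)) by exact: within_filter.
  move=> /(coord_cvg (i := 0) (j := a) phiy) Hz.
  have {}Hz : \forall z \near y, U z -> phi z 0 a != 0 := Hz.
  by apply: filterS Hz => z Hz Uz _; rewrite inE; exact: Hz.
have := filter_forall (nbhs_filter y) H; apply: filterS2 nU => z Uz Hz.
split=> //; apply/fintype.subsetP => a; apply: contraTT => aN; exact: Hz.
Qed.

Lemma box_zeros v : B v -> zeros v \subset Z.
Proof.
move=> [_ [_ vB]]; apply/fintype.subsetP => a; rewrite [in X in X -> _]inE => /eqP va.
apply/negPn/negP => /gap; have := vB 0 a; rewrite /ball/= va subr0.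
by have := ler_norm (phi x 0 a); lra.
Qed.

(** The box is convex, and along the segment coordinate [a] stays zero while the others stay
    positive, so the segment consists of points of codimension 1. *)
Lemma piece_connected a y y' : U y -> U y' -> zeros (phi y) = [set a]%SET ->
  zeros (phi y') = [set a]%SET -> connected_component (codim_set A 1) y y'.
Proof.
move=> Uy Uy' zy zy'.
have [[y_ge0 [_ yB]] [y'_ge0 [_ y'B]]] := (phiB Uy, phiB Uy').
pose p (t : R) := phi y + t *: (phi y' - phi y).
have pE t b : p t 0 b = (1 - t) * phi y 0 b + t * phi y' 0 b.
  by rewrite !mxE; ring.
have pB t : `[0, 1]%classic t -> B (p t) /\ zeros (p t) = [set a]%SET.
  rewrite /= in_itv/= => /andP[t0 t1]; split; first split.
  - by move=> b; rewrite pE addr_ge0// mulr_ge0// subr_ge0.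
  - split=> // i b; rewrite {i}ord1 /ball/= pE.
    have := yB 0 b; have := y'B 0 b; rewrite /ball/= !ltr_norml.
    move=> /andP[h1 h2] /andP[h3 h4].
    have [le|/ltW le] := leP (phi y 0 b) (phi y' 0 b).
      have := ler_wpM2l t0 le; have : 0 <= (1 - t) * (phi y' 0 b - phi y 0 b).
        by rewrite mulr_ge0 ?subr_ge0.
      by move=> ? ?; apply/andP; split; lra.
    have := ler_wpM2l t0 le; have : 0 <= (1 - t) * (phi y 0 b - phi y' 0 b).
      by rewrite mulr_ge0 ?subr_ge0.
    by move=> ? ?; apply/andP; split; lra.
  - apply/setP => b; rewrite !inE pE.
    have yb : (phi y 0 b == 0) = (b == a) by move/setP/(_ b): zy; rewrite !inE.
    have y'b : (phi y' 0 b == 0) = (b == a) by move/setP/(_ b): zy'; rewrite !inE.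
    have [ba|ba] := eqVneq b a.
      have /eqP -> : phi y 0 b == 0 by rewrite yb ba.
      have /eqP -> : phi y' 0 b == 0 by rewrite y'b ba.
      by rewrite !mulr0 addr0 eqxx.
    have {}yb : 0 < phi y 0 b by rewrite lt_neqAle eq_sym yb ba y_ge0.
    have {}y'b : 0 < phi y' 0 b by rewrite lt_neqAle eq_sym y'b ba y'_ge0.
    by apply/gt_eqF; nra.
have p_cont : continuous p.
  move=> t; apply: (@cvgD _ _ _ (nbhs t)); first exact: cvg_cst.
  by apply: (@cvgZ _ _ _ (nbhs t)); [exact: cvg_id|exact: cvg_cst].
have q_cont : {within `[0, 1], continuous (phi' \o p)}.
  apply/subspace_continuousP => t t01.
  apply: (cvg_within_comp (g := p) phi'_cont); first by have [] := pB _ t01.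
    apply: cvg_trans (p_cont t); apply: cvg_app; exact: cvg_within.
  by apply: (@filterE _ (nbhs t)) => u /pB[].
have := connected_continuous_connected (@segment_connected R 0 1) q_cont.
set C := [set _ | _ in _]; move=> cC.
have Cy : C y by exists 0; rewrite /= ?in_itv/= ?lexx ?ler01// /p scale0r addr0 phiK.
have Cy' : C y'.
  by exists 1; rewrite /= ?in_itv/= ?lexx ?ler01// /p scale1r addrC subrK phiK.
apply: (connected_component_max Cy _ cC) => // _ [t t01 <-].
have [Bt zt] := pB _ t01.
by apply/codimE; [exact: phi'U|rewrite phi'K// zt cards1].
Qed.

(** [y] is in the closure of a codimension 1 stratum inside M_i. Points of that stratum near [y]
    vanish in one coordinate [a], which vanishes at [y] too; the piece of this hyperplane is
    connected, hence in the same stratum. *)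
Lemma stratum_piece y i : U y -> F i y -> exists2 a, a \in zeros (phi y) &
  forall y', U y' -> zeros (phi y') = [set a]%SET -> F i y'.
Proof.
move=> Uy Fy; have : face F [set i]%SET y by move=> j /=; rewrite inE => /eqP ->.
move=> /face_stratum[z []]; rewrite cards1 => z1 zy zF.
have [u [zu [Uu uy]]] := zy _ (near_zeros Uy).
have /codimE := connected_component_sub zu; move=> /(_ Uu)/eqP/cards1P[a ua].
exists a => [|y' Uy' y'a]; first by apply: (fintype.subsetP uy); rewrite ua inE.
have : face F [set i]%SET y'; last by apply; rewrite /= inE.
apply: zF; apply: subset_closure.
by rewrite (same_connected_component zu); exact: piece_connected ua y'a.
Qed.

(** Raising all coordinates but [a] approximates a point of the hyperplane of [a] by points lying on
    no other hyperplane. *)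
Definition shift_off v a (t : R) : 'rV[R]_m := v + t *: \row_b (b != a)%:R.

Lemma zeros_shift_off v a t : @orthant R m v -> v 0 a = 0 -> 0 < t ->
  @orthant R m (shift_off v a t) /\ zeros (shift_off v a t) = [set a]%SET.
Proof.
move=> v_ge0 va t0; split=> [b|].
  by rewrite !mxE addr_ge0// mulr_ge0// ltW.
apply/setP => b; rewrite !inE !mxE; have [->|ba] := eqVneq b a.
  by rewrite va mulr0 addr0 eqxx.
by rewrite mulr1; apply/gt_eqF; have := v_ge0 b; lra.
Qed.

Lemma shift_off_cvg v a : shift_off v a t @[t --> 0^'+] --> v.
Proof.
rewrite -[X in _ --> X]addr0; apply: cvgD; first exact: cvg_cst.
rewrite -[X in _ --> X](scale0r (\row_b (b != a)%:R)).
by apply: cvgZ; [exact: cvg_at_right_filter|exact: cvg_cst].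
Qed.

Lemma box_shift_off y a : U y -> phi y 0 a = 0 ->
  \forall t \near 0^'+, B (shift_off (phi y) a t) /\
    zeros (shift_off (phi y) a t) = [set a]%SET.
Proof.
move=> Uy ya; have [y_ge0 yB] := phiB Uy.
have nB : nbhs (phi y) (ball (phi x) eps).
  by apply: open_nbhs_nbhs; split=> //; exact: ball_open.
have Hb : \forall t \near 0^'+, ball (phi x) eps (shift_off (phi y) a t) :=
  shift_off_cvg a nB.
have Hp : \forall t \near (0:R)^'+, 0 < t by exact: nbhs_right_gt.
apply: filterS2 Hb Hp => t tB t0.
by have [] := zeros_shift_off y_ge0 ya t0.
Qed.

Lemma piece_closure y i a : U y -> phi y 0 a = 0 ->
  (forall y', U y' -> zeros (phi y') = [set a]%SET -> F i y') -> F i y.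
Proof.
move=> Uy ya aF.
have cv : phi' (shift_off (phi y) a t) @[t --> 0^'+] --> y.
  rewrite -[X in _ --> X]phiK//.
  apply: (cvg_within_comp (g := shift_off (phi y) a) phi'_cont); first exact: phiB.
    exact: shift_off_cvg.
  by apply: filterS (box_shift_off Uy ya) => t [].
apply: (@closed_cvg _ _ _ (at_right_proper_filter (0 : R)) _ (F i)
  (@corner_closed i) _ _ cv).
apply: filterS (box_shift_off Uy ya) => t [tB tz].
by apply: aF; [exact: phi'U|rewrite phi'K].
Qed.

Lemma piece_ex a : a \in Z -> exists2 y, U y & zeros (phi y) = [set a]%SET.
Proof.
rewrite inE => /eqP xa.
have [t [tB tz]] := @filter_ex _ _ (at_right_proper_filter (0 : R)) _ (box_shift_off Ux xa).
by exists (phi' (shift_off (phi x) a t)); rewrite ?phi'K //; exact: phi'U.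
Qed.

(** Covering of the boundary provides [i]. A second index would put a point of the piece in the
    closure of the codimension 2 points, whereas near it at most one coordinate vanishes. *)
Lemma piece_color a : a \in Z -> exists i, forall j,
  (forall y, U y -> zeros (phi y) = [set a]%SET -> F j y) <-> j = i.
Proof.
move=> aZ; have [y Uy ya] := piece_ex aZ.
have /boundaryF[i _ Fy] : mwc_boundary A y.
  by exists 1%N => //; apply/codimE; rewrite // ya cards1.
have iP z : U z -> zeros (phi z) = [set a]%SET -> F i z.
  have [b] := stratum_piece Uy Fy; rewrite ya inE => /eqP ->; exact.
exists i => j; split=> [jP|-> //]; apply/eqP/negPn/negP => ji.
have : face F [set i; j]%SET y.
  by move=> k; rewrite /= !inE => /orP[] /eqP ->; [exact: iP|exact: jP].
move=> /face_stratum[z []]; rewrite cards2 eq_sym ji => _ zy _.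
have [u [zu [Uu uy]]] := zy _ (near_zeros Uy).
have /codimE := connected_component_sub zu; move=> /(_ Uu) u2.
by have := subset_leq_card uy; rewrite u2 ya cards1.
Qed.

Lemma box_color : exists tau : 'I_m -> 'I_n.+1, forall y i, U y ->
  F i y <-> exists a, [/\ a \in Z, tau a = i & phi y 0 a = 0].
Proof.
have [tau tauP] : {tau : 'I_m -> 'I_n.+1 & forall a, a \in Z -> forall j,
    (forall y, U y -> zeros (phi y) = [set a]%SET -> F j y) <-> j = tau a}%type.
  apply: (@choice _ _ (fun a i => a \in Z -> forall j,
    (forall y, U y -> zeros (phi y) = [set a]%SET -> F j y) <-> j = i)) => a.
  have [aZ|aZ] := boolP (a \in Z); last by exists ord0.
  by have [i iP] := piece_color aZ; exists i.
exists tau => y i Uy; split=> [Fy|[a [aZ <- ya]]].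
  have [a ay aF] := stratum_piece Uy Fy; exists a.
  have aZ : a \in Z by apply: (fintype.subsetP (box_zeros (phiB Uy))).
  by split=> //; [apply/esym/tauP|move: ay; rewrite inE => /eqP].
by apply: piece_closure ya _ => //; apply/tauP.
Qed.

End Box.

Lemma colored_chart_ex x : exists (U : set M) (psi : M -> 'rV[R]_(n.+1 + (m - n.+1))),
  U x /\ colored_chart F U psi.
Proof.
have mE : (n.+1 + (m - n.+1) = m)%N by rewrite subnKC ?corner_dim_ge.
have [U [phi [phi' [eps [[oU Ux eps0 gap] [phiB phi'U] [phiK phi'K] [cphi cphi'] codimE]]]]] :=
  corner_box_chart x.
have [tau tauP] := box_color oU Ux eps0 gap phiB phi'U phiK phi'K cphi cphi' codimE.
have v0Z a : a \in zeros (phi x) -> phi x 0 a = 0 by rewrite inE => /eqP.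
have [e [e' [eK e'K eR]]] := straightening_index (zeros (phi x)) tau mE.
pose g := straighten (zeros (phi x)) tau eps.
pose g' := bend (zeros (phi x)) tau eps.
pose G v : 'rV[R]_(n.+1 + (m - n.+1)) := \row_j g v 0 (e j).
pose H (y : 'rV[R]_(n.+1 + (m - n.+1))) : 'rV[R]_m := \row_a y 0 (e' a).
have HG v : H (G v) = g v by apply/matrixP => z a; rewrite 2!mxE e'K (ord1 z).
have GH y : G (g' (H y)) = y.
  apply/matrixP => z j; rewrite ord1 mxE.
  have -> : g (g' (H y)) = H y by exact: bendK.
  by rewrite mxE eK.
have cG : continuous G.
  move=> v; apply/(@mx_cvgP _ _ _ _ _ (nbhs v)) => z j; rewrite {z}ord1 mxE.
  under eq_fun do rewrite mxE.
  exact: (@coord_cvg _ _ _ _ g (nbhs v) _ (g v) 0 (e j) (@straighten_cont _ _ _ _ _ _ v)).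
have cH : continuous H.
  move=> v; apply/(@mx_cvgP _ _ _ _ _ (nbhs v)) => z a; rewrite {z}ord1 mxE.
  under eq_fun do rewrite mxE.
  exact: (@coord_cvg _ _ _ _ id (nbhs v) _ v 0 (e' a) (@cvg_id _ _)).
have cg'H : continuous (g' \o H).
  move=> y; apply: (@cvg_comp _ _ _ H g' _ (nbhs (H y))); [exact: cH|exact: bend_cont].
(* A color absent from the corner: M_i misses [U], and coordinate [i] must not vanish there. It does
   not, as [e] gave it a coordinate that represents no color. *)
have Gpos v i : corner_box (phi x) eps v -> rep_opt (zeros (phi x)) tau i = None ->
    0 < G v 0 (lshift _ i).
  move=> [v_ge0 vB] iN; rewrite mxE.
  apply: (straighten_pos v0Z gap) => //.
  have [eZ|eZ] := boolP (e (lshift (m - n.+1) i) \in zeros (phi x)); last by left.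
  right; apply/negP => /eqP er.
  move: er; rewrite /rep; case Et: (rep_opt _ _ _) => [b|] /= er.
    have := eR _ _ Et; rewrite -er => /(can_inj eK)/lshift_inj it.
    by move: iN; rewrite -it Et.
  move: Et; rewrite /rep_opt; case: pickP => // /(_ (e (lshift _ i))).
  by rewrite eZ eqxx.
have Grep v i b : corner_box (phi x) eps v -> rep_opt (zeros (phi x)) tau i = Some b ->
    0 <= G v 0 (lshift _ i) /\ (G v 0 (lshift _ i) = 0 <->
      exists a, [/\ a \in zeros (phi x), tau a = i & v 0 a = 0]).
  move=> [v_ge0 vB] ib; rewrite mxE (eR _ _ ib).
  have [bZ bi] : b \in zeros (phi x) /\ tau b = i.
    by move: ib; rewrite /rep_opt; case: pickP => // c /andP[cZ /eqP ci] [<-].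
  rewrite -bi; apply: straighten_rep => //.
  by rewrite /rep bi ib.
have GB v : corner_box (phi x) eps v -> @orthant R n.+1 (lsubmx (G v)).
  move=> vB i; rewrite mxE; case Ei: (rep_opt (zeros (phi x)) tau i) => [b|].
    by have [] := Grep _ _ _ vB Ei.
  by apply/ltW; exact: Gpos.
have g'B y : @orthant R n.+1 (lsubmx y) -> ball (phi x) eps (g' (H y)) ->
    corner_box (phi x) eps (g' (H y)).
  move=> y_ge0 yB; split=> //; apply: (bend_ge0 gap) => // a aZ ar.
  rewrite mxE; have := y_ge0 (tau a); rewrite mxE.
  suff -> : lshift (m - n.+1) (tau a) = e' a by [].
  apply: (can_inj eK); rewrite e'K.
  case Et: (rep_opt (zeros (phi x)) tau (tau a)) => [b|].
    by rewrite (eR _ _ Et) (eqP ar) /rep Et.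
  by move: Et; rewrite /rep_opt; case: pickP => // /(_ a); rewrite aZ eqxx.
exists U, (G \o phi); split=> //; split; last first.
  move=> y Uy; apply/setP => i; rewrite !inE mxE /=.
  apply/asboolP/eqP => [/(tauP y i Uy)|].
    case Ei: (rep_opt (zeros (phi x)) tau i) => [b|] Fy.
      by have [_ [_]] := Grep _ _ _ (phiB _ Uy) Ei; exact.
    case: Fy => a [aZ ai _]; move: Ei; rewrite /rep_opt; case: pickP => // /(_ a).
    by rewrite aZ ai eqxx.
  case Ei: (rep_opt (zeros (phi x)) tau i) => [b|] Gy.
    by apply/(tauP y i Uy); have [_ [+ _]] := Grep _ _ _ (phiB _ Uy) Ei; exact.
  by have := Gpos _ _ (phiB _ Uy) Ei; rewrite Gy ltxx.
split=> //; exists [set y | ball (phi x) eps (g' (H y))].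
  rewrite openE => y yB; have := cg'H y.
  by apply; apply: open_nbhs_nbhs; split=> //; exact: ball_open.
exists (phi' \o (g' \o H)); split.
- split=> [y Uy|y [y_ge0 yB]]; last by apply: phi'U; exact: g'B.
  split; first by apply: GB; exact: phiB.
  rewrite /= HG; have -> : g' (g (phi y)) = phi y by exact: straightenK.
  by have [] := phiB _ Uy.
- split=> [y Uy|y [y_ge0 yB]] /=.
    by rewrite HG; have -> : g' (g (phi y)) = phi y by [exact: straightenK]; exact: phiK.
  by rewrite phi'K ?GH//; exact: g'B.
- apply/subspace_continuousP => y Uy.
  have FW : Filter (within U (nbhs y)) by exact: within_filter.
  apply: (@cvg_comp _ _ _ phi G _ (nbhs (phi y))); last exact: cG.
  by have /subspace_continuousP/(_ y Uy) := cphi.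
- apply/subspace_continuousP => y [y_ge0 yB].
  set W := within _ _; have FW : Filter W by exact: within_filter.
  apply: (cvg_within_comp (g := g' \o H) cphi'); first exact: g'B.
    by apply: cvg_trans (cg'H y); apply: cvg_app; exact: cvg_within.
  by apply: (@filterE _ (nbhs y)) => z [z_ge0 zB]; exact: g'B.
Qed.

End LocalColoring.

Theorem proposition4p4 (R : realType) (m n : nat) (M : topologicalType)
    (A : manifold_with_corners R m M) (F : 'I_n.+1 -> set M)
    (cornerF : corner_of_manifolds A F)
    (compactM : compact [set: M])
    (boundaryF : mwc_boundary A `<=` \bigcup_(i in [set: 'I_n.+1]) F i) :
  (forall (gT : finGroupType) (s : 'I_n.+1 -> gT),
     finite_coxeter_system s ->
     closed_manifold R (basic_construction s F)) /\
  (forall (V : finType) (L : {set {set V}}) (f : V -> 'I_n.+1),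
     triangulates_a_sphere R L ->
     coloring L f ->
     closed_manifold R (pullback L f F)).
Proof.
have M_chart := colored_chart_ex cornerF boundaryF.
have Fcl := corner_closed cornerF.
have [[_ _ F_ex] _] := cornerF.
have M_hausdorff := mwc_hausdorff A; have M_second := mwc_second_countable A.
split=> [gT s coxs|V L f sphereL colorL].
  exact: (basic_construction_manifold coxs Fcl M_hausdorff M_second compactM M_chart).
exact: (pullback_manifold sphereL colorL Fcl (F_ex _) M_hausdorff M_second compactM M_chart).
Qed.
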